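(* Let $n \ge 2$ be an integer and let $\mu := (1,0,\dots,0) \in \mathbb{Z}^n$. Let $\widetilde W$ be the Iwahori-Weyl group attached to the split group $O_{2n}$ or $O_{2n+1}$; that is, let $\widetilde W$ be either $\widetilde W_{2n}$ or $\widetilde W_{2n+1}$ (with their respective affine Weyl groups and Bruhat orders). Then there is an equality of subsets of $\widetilde W$, $$\mathrm{Adm}(\mu) = \mathrm{Perm}(\mu).$$
   Context: Fix $n \ge 2$ and write $i^* := 2n+1-i$. Let $S_{2n}$ be the symmetric group on $\{1,\dots,2n\}$; let $S^*_{2n} \subset S_{2n}$ be the subgroup of $\sigma$ with $\sigma(i^* ) = \sigma(i)^*$ for all $i$, and $S^\circ_{2n} \subset S^*_{2n}$ the subgroup of elements that are even permutations in $S_{2n}$. One has $S^*_{2n} = \{\pm1\}^n \rtimes S_n$, acting on $\mathbb{Z}^n$ and $\mathbb{R}^n$ by permutations of the entries and sign changes (equivalently: embed $(x_1,\dots,x_n) \mapsto (x_1,\dots,x_n,-x_n,\dots,-x_1)$ and let $S^*_{2n}$ permute the $2n$ coordinates by $\sigma e_i = e_{\sigma(i)}$). Groups. As abstract groups, $\widetilde W_{2n} = \widetilde W_{2n+1} := \mathbb{Z}^n \rtimes S^*_{2n}$; this acts on $\mathbb{R}^n$ by affine transformations. For $\nu \in \mathbb{Z}^n$, $t_\nu$ denotes $\nu$ regarded as an element of the group (translation by $\nu$). Let $Q^\vee := \{(x_1,\dots,x_n) \in \mathbb{Z}^n : \sum_i x_i \text{ is even}\}$. The affine Weyl groups are $W_{\mathrm{a},2n}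 := Q^\vee \rtimes S^\circ_{2n}$ (even case) and $W_{\mathrm{a},2n+1} := Q^\vee \rtimes S^*_{2n}$ (odd case). The finite Weyl group $W$ is $S^\circ_{2n}$ (or, equivalently for the orbit of $\mu$ considered here, $S_{2n}^*$) in the even case and $S^*_{2n}$ in the odd case; in both cases $W\mu = \{\pm e_1,\dots,\pm e_n\}$. Roots and alcoves. Even case: the roots are $\pm x_i \pm x_j$ ($1 \le i<j\le n$), with simple roots $x_i - x_{i+1}$ ($1\le i \le n-1$) and $x_{n-1}+x_n$. Odd case: the roots are $\pm x_i$ ($1 \le i \le n$) and $\pm x_i \pm x_j$ ($1 \le i<j\le n$), with simple roots $x_i - x_{i+1}$ ($1 \le i \le n-1$) and $x_n$. In each case the alcoves are the connected components of the complement in $\mathbb{R}^n$ of all hyperplanes $\{\alpha = d\}$, $\alpha$ a root, $d \in \mathbb{Z}$. The base alcove $A$ is the alcove contained in the positive Weyl chamber (where all simple roots are positive) whose closure contains the origin. Bruhat order. In each case the affine Weyl group $W_{\mathrm a}$ is a Coxeter group generated by the reflections across the walls of $A$, which gives a Bruhat order on $W_{\mathrm a}$. Let $\Omega$ be the stabilizer of $A$ in $\widetilde W$; then $\widetilde W = W_{\mathrm a} \rtimes \Omega$, and for $x,x' \in W_{\mathrm a}$, $\omega,\omega' \in \Omega$ one sets $x\omega \le x'\omega'$ iff $\omega = \omega'$ and $x \le x'$ in $W_{\mathrm a}$. Admissible and permissible sets: $$\mathrm{Adm}(\mu) := \{w \in \widetilde W : w \le t_{\mu'} \text{ for some } \mu'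 \in W\mu\},$$ $$\mathrm{Perm}(\mu) := \{w \in \widetilde W : w \equiv t_\mu \bmod W_{\mathrm a} \text{ and } wa - a \in \mathrm{Conv}(W\mu) \text{ for all } a \in A\},$$ where $\mathrm{Conv}(W\mu)$ is the convex hull of $W\mu$ in $\mathbb{R}^n$. *)

(* Defs.v *)
From HB Require Import structures.
From Stdlib Require Import Relation_Operators.
From mathcomp Require Import all_boot all_order all_algebra all_fingroup.
From mathcomp Require Import all_classical all_reals all_analysis.

Set Implicit Arguments.
Unset Strict Implicit.
Unset Printing Implicit Defensive.

Import Order.TTheory GRing.Theory Num.Theory.
Import numFieldNormedType.Exports.

Local Open Scope classical_set_scope.
Local Open Scope ring_scope.

(* Indices are 0-based: {1, ..., 2n} becomes 'I_(n + n), and i^* = 2n + 1 - i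
   becomes rev_ord i. *)
Definition Sstar (n : nat) : {set 'S_(n + n)} :=
  [set s : 'S_(n + n) | [forall i, s (rev_ord i) == rev_ord (s i)]].

Lemma SstarP (n : nat) (s : 'S_(n + n)) :
  reflect (forall i, s (rev_ord i) = rev_ord (s i)) (s \in Sstar n).
Proof. by rewrite inE; apply: (iffP forallP) => H i; apply/eqP. Qed.

Lemma Sstar_group_set (n : nat) : group_set (Sstar n).
Proof.
apply/group_setP; split; first by apply/SstarP => i; rewrite !perm1.
move=> s t /SstarP Hs /SstarP Ht; apply/SstarP => i.
by rewrite !permM Hs Ht.
Qed.

Canonical Sstar_group (n : nat) : {group 'S_(n + n)} :=
  Group (@Sstar_group_set n).

Definition sstar (n : nat) : Type := [subg Sstar_group n].
HB.instance Definition _ (n : nat) := FinGroup.on (sstar n).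

(* S_{2n}^circ; the sign is that of the permutation of all 2n indices. *)
Definition Scirc (n : nat) : {set sstar n} :=
  [set s : sstar n | ~~ odd_perm (sgval s)].

Section SignedAction.
Variables (V : zmodType) (n : nat).
Implicit Types (x y : 'rV[V]_n) (s t : sstar n).

(* (x_1, ..., x_n) |-> (x_1, ..., x_n, - x_n, ..., - x_1) *)
Definition sym_embed x : 'rV[V]_(n + n) :=
  row_mx x (- \row_j x 0 (rev_ord j)).

(* The action of S^*_{2n} on V^n for V = Z or R, with s e_i = e_(s i) on the
   2n coordinates: coordinate j of s x is coordinate s^-1 j of x. *)
Definition sact s x : 'rV[V]_n :=
  lsubmx (col_perm (sgval s)^-1%g (sym_embed x)).

Lemma sym_embed_rev x i : sym_embed x 0 (rev_ord i) = - sym_embed x 0 i.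
Proof.
case: (split_ordP i) => j ->.
  have -> : rev_ord (lshift n j) = rshift n (rev_ord j).
    by apply: val_inj; rewrite /= -addnBA.
  by rewrite row_mxEr row_mxEl !mxE rev_ordK.
have -> : rev_ord (rshift n j) = lshift n (rev_ord j).
  by apply: val_inj => /=; rewrite -addnS subnDl.
by rewrite row_mxEr row_mxEl !mxE opprK.
Qed.

Lemma sym_embed_lsubmx (z : 'rV[V]_(n + n)) :
  (forall i, z 0 (rev_ord i) = - z 0 i) -> sym_embed (lsubmx z) = z.
Proof.
move=> Hz; apply/rowP => i; case: (split_ordP i) => j ->.
  by rewrite row_mxEl !mxE.
rewrite row_mxEr !mxE -Hz; congr (z _ _).
apply: val_inj; rewrite /= -addnBA ?(ltn_ord (rev_ord j)) //.
by rewrite -[in RHS](rev_ordK j).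
Qed.

Lemma sym_embed_sact s x :
  sym_embed (sact s x) = col_perm (sgval s)^-1%g (sym_embed x).
Proof.
apply: sym_embed_lsubmx => i; rewrite [LHS]mxE [X in - X]mxE.
have /SstarP -> : (sgval s)^-1%g \in Sstar n by rewrite groupV; exact: subgP.
exact: sym_embed_rev.
Qed.

Lemma sym_embedK x : lsubmx (sym_embed x) = x.
Proof. exact: row_mxKl. Qed.

Lemma sym_embedD x y : sym_embed (x + y) = sym_embed x + sym_embed y.
Proof.
rewrite /sym_embed add_row_mx -opprD; congr (row_mx _ (- _)).
by apply/rowP => i; rewrite !mxE.
Qed.

Lemma sactD s x y : sact s (x + y) = sact s x + sact s y.
Proof. by rewrite /sact sym_embedD; apply/rowP => i; rewrite !mxE. Qed.

Lemma sact0 s : sact s 0 = 0 :> 'rV[V]_n.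
Proof. by apply: (addrI (sact s 0)); rewrite -sactD !addr0. Qed.

Lemma sactN s x : sact s (- x) = - sact s x.
Proof. by apply: (addrI (sact s x)); rewrite -sactD !subrr sact0. Qed.

Lemma sact1 x : sact 1%g x = x.
Proof. by rewrite /sact invg1 col_perm1 sym_embedK. Qed.

(* Products in a permutation group are read from left to right, so that
   (t * s)%g is the composite "t, then s". *)
Lemma sactM s t x : sact (t * s)%g x = sact s (sact t x).
Proof.
by rewrite {2}/sact sym_embed_sact -col_permM /sact -invMg.
Qed.

End SignedAction.

(* The Iwahori-Weyl group Z^n x| S^*_{2n}. *)
Record iwahori (n : nat) := Iwahori { tpart : 'rV[int]_n; spart : sstar n }.

Section IwahoriGroup.
Variable n : nat.
Implicit Types w : iwahori n.

Definition iwahori_pair w := (tpart w, spart w).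
Definition pair_iwahori (p : 'rV[int]_n * sstar n) := Iwahori p.1 p.2.
Lemma iwahori_pairK : cancel iwahori_pair pair_iwahori.
Proof. by case. Qed.

HB.instance Definition _ := Choice.copy (iwahori n) (can_type iwahori_pairK).

Definition iwahori_one : iwahori n := Iwahori 0 1%g.
(* The linear part of w1 w2 is the composite "w2, then w1"; see sactM for the
   order of the factors. *)
Definition iwahori_mul w1 w2 : iwahori n :=
  Iwahori (tpart w1 + sact (spart w1) (tpart w2)) (spart w2 * spart w1)%g.
Definition iwahori_inv w : iwahori n :=
  Iwahori (- sact (spart w)^-1%g (tpart w)) (spart w)^-1%g.

Lemma iwahori_mulA : associative iwahori_mul.
Proof.
move=> w1 w2 w3; rewrite /iwahori_mul /=; congr Iwahori.
  by rewrite sactD sactM addrA.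
by rewrite mulgA.
Qed.

Lemma iwahori_mul1 : left_id iwahori_one iwahori_mul.
Proof. by case=> v s; rewrite /iwahori_mul /= sact1 add0r mulg1. Qed.

Lemma iwahori_mulr1 : right_id iwahori_one iwahori_mul.
Proof. by case=> v s; rewrite /iwahori_mul /= sact0 addr0 mul1g. Qed.

Lemma iwahori_mulV : left_inverse iwahori_one iwahori_inv iwahori_mul.
Proof. by case=> v s; rewrite /iwahori_mul /= addNr mulgV. Qed.

Lemma iwahori_mulrV : right_inverse iwahori_one iwahori_inv iwahori_mul.
Proof.
by case=> v s; rewrite /iwahori_mul /= sactN -sactM mulVg sact1 subrr.
Qed.

HB.instance Definition _ := isGroup.Build (iwahori n)
  iwahori_mulA iwahori_mul1 iwahori_mulr1 iwahori_mulV iwahori_mulrV.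

End IwahoriGroup.

Definition translation (n : nat) (v : 'rV[int]_n) : iwahori n :=
  Iwahori v 1%g.

(* The affine action on R^n. *)
Definition aff_act (R : realType) (n : nat) (w : iwahori n) (x : 'rV[R]_n) :
  'rV[R]_n := map_mx intr (tpart w) + sact (spart w) x.

Lemma map_sact (R : realType) (n : nat) (s : sstar n) (v : 'rV[int]_n) :
  map_mx intr (sact s v) = sact s (map_mx intr v) :> 'rV[R]_n.
Proof.
have E : map_mx intr (sym_embed v) = sym_embed (map_mx intr v) :> 'rV[R]__.
  rewrite /sym_embed map_row_mx; congr row_mx.
  by apply/rowP => i; rewrite !mxE rmorphN.
by rewrite /sact -E; apply/rowP => i; rewrite !mxE.
Qed.

Lemma aff_actM (R : realType) (n : nat) (w1 w2 : iwahori n) (x : 'rV[R]_n) :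
  aff_act (w1 * w2)%g x = aff_act w1 (aff_act w2 x).
Proof.
rewrite /aff_act /= sactD sactM addrA; congr (_ + _).
by rewrite map_mxD; congr (_ + _); exact: map_sact.
Qed.

(* Bruhat order of a Coxeter system (W, S) inside an ambient group, generated by
   x < t x for t conjugate to an element of S and length x < length (t x). *)
Section Coxeter.
Variables (G : groupType) (W S : set G).

Definition is_word (k : nat) (w : G) : Prop :=
  exists2 s : seq G, size s = k /\ (forall g, g \in s -> S g)
                   & w = (\prod_(g <- s) g)%g.

Definition cox_length (w : G) : nat :=
  get [set k | is_word k w /\ (forall j, is_word j w -> (k <= j)%N)].

Definition cox_reflection : set G :=
  [set t | exists g s, [/\ W g, S s & t = (g * s * g^-1)%g]].

Definition bruhat_step (x y : G) : Prop :=
  [/\ W x, exists2 t, cox_reflection t & y = (t * x)%g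
    & (cox_length x < cox_length y)%N].

Definition bruhat (x y : G) : Prop := W x /\ clos_refl_trans G bruhat_step x y.

End Coxeter.

Inductive orthogonal_type := EvenOrthogonal | OddOrthogonal.

Definition coroot_lattice (n : nat) : set 'rV[int]_n :=
  [set v : 'rV[int]_n | (2 %| \sum_i v 0 i)%Z].

Definition finite_weyl (c : orthogonal_type) (n : nat) : set (sstar n) :=
  match c with
  | EvenOrthogonal => [set s | s \in Scirc n]
  | OddOrthogonal => setT
  end.

Definition affine_weyl (c : orthogonal_type) (n : nat) : set (iwahori n) :=
  [set w | coroot_lattice (tpart w) /\ finite_weyl c (spart w)].

Section Alcoves.
Variables (R : realType) (c : orthogonal_type) (n : nat).
Implicit Types (x y : 'rV[R]_n) (A : set 'rV[R]_n) (d e : int).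

Definition dot x y : R := \sum_i x 0 i * y 0 i.

Local Notation "''e_' i" := (delta_mx 0 i : 'rV[R]_n)
  (at level 8, i at level 2, format "''e_' i").

(* A root is identified with its coefficient vector, its value at x being
   dot alpha x. *)
Definition long_roots : set 'rV[R]_n :=
  [set a | exists (i j : 'I_n) (b b' : bool),
     (i < j)%N /\ a = (-1) ^+ b *: 'e_i + (-1) ^+ b' *: 'e_j].

Definition short_roots : set 'rV[R]_n :=
  [set a | exists (i : 'I_n) (b : bool), a = (-1) ^+ b *: 'e_i].

Definition root_system : set 'rV[R]_n :=
  match c with
  | EvenOrthogonal => long_roots
  | OddOrthogonal => short_roots `|` long_roots
  end.

Definition last_simple_root : set 'rV[R]_n :=
  match c with
  | EvenOrthogonal =>
      [set a | exists i j : 'I_n, [/\ i.+2 = n, j.+1 = n & a = 'e_i + 'e_j]]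
  | OddOrthogonal => [set a | exists2 i : 'I_n, i.+1 = n & a = 'e_i]
  end.

Definition simple_roots : set 'rV[R]_n :=
  [set a | exists i j : 'I_n, j = i.+1 :> nat /\ a = 'e_i - 'e_j]
  `|` last_simple_root.

Definition hyperplane (a : 'rV[R]_n) d : set 'rV[R]_n :=
  [set x | dot a x = d%:~R].

Definition regular_points : set 'rV[R]_n :=
  ~` [set x | exists a d, root_system a /\ hyperplane a d x].

Definition alcove A : Prop :=
  exists2 x, regular_points x & A = connected_component regular_points x.

Definition positive_chamber : set 'rV[R]_n :=
  [set x | forall a, simple_roots a -> 0 < dot a x].

Definition base_alcove : set 'rV[R]_n :=
  get [set A | [/\ alcove A, A `<=` positive_chamber & closure A 0]].

(* {a = d} supports a facet of A of codimension one: some point of the closure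
   of A lies on this hyperplane of the arrangement and on no other one. *)
Definition wall A (a : 'rV[R]_n) d : Prop :=
  root_system a /\
  exists x, [/\ closure A x, hyperplane a d x
    & forall a' d', root_system a' -> hyperplane a' d' x ->
        hyperplane a' d' = hyperplane a d].

Definition hyperplane_reflection (a : 'rV[R]_n) d x : 'rV[R]_n :=
  x - (2 * (dot a x - d%:~R) / dot a a) *: a.

Definition simple_reflections : set (iwahori n) :=
  [set s | affine_weyl c s /\
     exists a d, wall base_alcove a d /\
       forall x, aff_act s x = hyperplane_reflection a d x].

Definition alcove_stabilizer : set (iwahori n) :=
  [set w | [set aff_act w x | x in base_alcove] = base_alcove].

Definition iwahori_le (w w' : iwahori n) : Prop :=
  exists u u' o, [/\ affine_weyl c u, affine_weyl c u', alcove_stabilizer o,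
    w = (u * o)%g /\ w' = (u' * o)%g
    & bruhat (@affine_weyl c n) simple_reflections u u'].

Definition weyl_orbit (m : 'rV[int]_n) : set 'rV[int]_n :=
  [set sact s m | s in finite_weyl c (n := n)].

Definition convex_hull (X : set 'rV[R]_n) : set 'rV[R]_n :=
  smallest (@convex_set R 'rV[R]_n) X.

Definition admissible_set (m : 'rV[int]_n) : set (iwahori n) :=
  [set w | exists2 m', weyl_orbit m m' & iwahori_le w (translation m')].

(* w = t_m mod W_a is w t_m^-1 \in W_a, W_a being normal. *)
Definition permissible_set (m : 'rV[int]_n) : set (iwahori n) :=
  [set w | affine_weyl c (w * (translation m)^-1)%g /\
     forall x, base_alcove x ->
       convex_hull [set map_mx intr m' | m' in weyl_orbit m]
         (aff_act w x - x)].

End Alcoves.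

Definition mu (n : nat) : 'rV[int]_n := \row_i (i == 0%N :> nat)%:R.

(* Main.v *)
Require Import Defs.
From Stdlib Require Import Relation_Operators.
From HB Require Import structures.
From mathcomp Require Import all_boot all_order all_algebra all_fingroup.
From mathcomp Require Import all_classical all_reals all_analysis.
From mathcomp Require Import ring lra zify.

Set Implicit Arguments.
Unset Strict Implicit.
Unset Printing Implicit Defensive.

Import Order.TTheory GRing.Theory Num.Theory.
Import numFieldNormedType.Exports.

Local Open Scope classical_set_scope.
Local Open Scope ring_scope.

(** Write [f = alpha - d] for an affine root and [A] for the base alcove. By the
    exchange condition, the reflection [t] in [f = 0] satisfies [x < t x] if and
    only if [f] does not separate [A] from [x A].

    Admissible elements are permissible: if [x < y = t x], then [f] separates
    [A] from [y A], hence for [a] in [A] the vector [x a - a] lies on the segment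
    from [v = y a - a] to [s_alpha v], which the Weyl-invariant convex hull
    contains.

    Conversely, let [w = t_nu sigma] be permissible. Then [nu = e_k] or
    [nu = - e_k], and [w] displaces each point [(1/2, ..., 1/2, 0, ..., 0)] of
    the closure of [A] by a vector of l^1-norm at most 1. If [sigma] is not 1, an
    explicit affine root [f], nonnegative on these points and on their images
    under [w], gives [t w > w] with the same bound on displacements. For a fixed
    [p] in [A], the distance from [t w p] to [p] is larger than that from [w p]
    to [p], so that the process stops, and it stops at a
    translation by an element of the orbit of [mu]. *)

(** * The 2n-coordinates *)

(** The points (1/2, ..., 1/2, 0, ..., 0), with 0 to n nonzero entries, are the vertices of the
    alcove of type C_n. That alcove lies in [A] in the even and in the odd case, which is why one
    argument serves both. Doubling the points makes the displacement bound a system of integer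
    inequalities. Moreover [base_point] is a convex combination of these points, so an affine root
    that is nonnegative at all of them is nonnegative there, and then positive because affine roots
    do not vanish on the orbit of [base_point].

    Of permissibility only three traces are kept: the odd coordinate sum of nu, the condition on
    sigma, and the displacement bound. All three survive a raising reflection. At the origin the
    bound reads |nu| <= 1, and parity excludes nu = 0; hence nu is a signed basis vector at every
    stage. This also bounds the distance from [w p] to [p], whose square becomes an integer after
    multiplication by (2n+1)^2, so that growth implies termination. *)

Lemma rev_ord_neq n (k : 'I_(n + n)) : (rev_ord k == k) = false.
Proof. by apply/eqP => /(congr1 val) /=; have := ltn_ord k; lia. Qed.

Lemma eq_revL n (k l : 'I_n) : (rev_ord k == l) = (k == rev_ord l).
Proof. by rewrite -(inj_eq rev_ord_inj) rev_ordK. Qed.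

Lemma half_ind n (P : 'I_(n + n) -> Prop) :
  (forall i, P (lshift n i)) -> (forall i, P (rev_ord (lshift n i))) ->
  forall k, P k.
Proof.
move=> Pl Pr k; case: (split_ordP k) => j -> //.
suff -> : rshift n j = rev_ord (lshift n (rev_ord j)) by [].
by apply: val_inj => /=; have := ltn_ord j; lia.
Qed.

Lemma rev_lshift_neq n (i j : 'I_n) : (rev_ord (lshift n i) == lshift n j) = false.
Proof. by apply/eqP => /(congr1 val) /=; have := ltn_ord i; have := ltn_ord j;
  lia. Qed.

Lemma sum_half (V : nmodType) n (F : 'I_(n + n) -> V) :
  (forall k, F (rev_ord k) = F k) ->
  \sum_k F k = (\sum_(i < n) F (lshift n i)) *+ 2.
Proof.
move=> Frev; rewrite big_split_ord mulr2n; congr (_ + _).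
rewrite (reindex_inj rev_ord_inj); apply: eq_bigr => i _.
rewrite -Frev; congr F; apply: val_inj => /=; have := ltn_ord i; lia.
Qed.

Lemma sgval_rev n (s : sstar n) k : sgval s (rev_ord k) = rev_ord (sgval s k).
Proof. by have /SstarP := subgP s. Qed.

Lemma sgvalV_rev n (s : sstar n) k :
  (sgval s)^-1%g (rev_ord k) = rev_ord ((sgval s)^-1%g k).
Proof. by apply: (@perm_inj _ (sgval s)); rewrite permKV sgval_rev permKV. Qed.

(** In these 2n coordinates a signed permutation acts by a plain permutation of indices, so that
    sign changes need no separate treatment. *)
Definition hat (V : zmodType) n (x : 'rV[V]_n) (k : 'I_(n + n)) : V :=
  sym_embed x 0 k.

Section HatTheory.
Variables (V : zmodType) (n : nat).
Implicit Types (x y : 'rV[V]_n) (s : sstar n).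

Lemma hat_lshift x i : hat x (lshift n i) = x 0 i.
Proof. by rewrite /hat /sym_embed row_mxEl. Qed.

Lemma hat_rev x k : hat x (rev_ord k) = - hat x k.
Proof. exact: sym_embed_rev. Qed.

Lemma hat_inj x y : (forall k, hat x k = hat y k) -> x = y.
Proof. by move=> e; apply/rowP => i; rewrite -!hat_lshift. Qed.

Lemma hatD x y k : hat (x + y) k = hat x k + hat y k.
Proof. by rewrite /hat sym_embedD mxE. Qed.

Lemma hat0 k : hat (0 : 'rV[V]_n) k = 0.
Proof. by apply: (addrI (hat 0 k)); rewrite -hatD !addr0. Qed.

Lemma hatN x k : hat (- x) k = - hat x k.
Proof. by apply: (addrI (hat x k)); rewrite -hatD !subrr hat0. Qed.

Lemma hatB x y k : hat (x - y) k = hat x k - hat y k.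
Proof. by rewrite hatD hatN. Qed.

Lemma hat_sact s x k : hat (sact s x) k = hat x ((sgval s)^-1%g k).
Proof. by rewrite /hat sym_embed_sact mxE. Qed.

Lemma hat_mulrn x m k : hat (x *+ m) k = hat x k *+ m.
Proof. by elim: m => [|m IH]; rewrite ?hat0 // !mulrS hatD IH. Qed.

End HatTheory.

Lemma hatZ (K : nzRingType) n (c : K) (x : 'rV[K]_n) k :
  hat (c *: x) k = c * hat x k.
Proof.
by elim/half_ind: k => i; rewrite ?hat_rev !hat_lshift mxE ?mulrN.
Qed.

Lemma hat_map (K : nzRingType) n (x : 'rV[int]_n) k :
  hat (map_mx intr x : 'rV[K]_n) k = (hat x k)%:~R.
Proof.
by elim/half_ind: k => i; rewrite ?hat_rev !hat_lshift mxE ?rmorphN.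
Qed.

Lemma hat_aff (R : realType) n (w : iwahori n) (x : 'rV[R]_n) k :
  hat (aff_act w x) k =
    (hat (tpart w) k)%:~R + hat x ((sgval (spart w))^-1%g k).
Proof. by rewrite /aff_act hatD hat_map hat_sact. Qed.

Lemma sactZ (K : nzRingType) n (s : sstar n) (c : K) (x : 'rV[K]_n) :
  sact s (c *: x) = c *: sact s x.
Proof. by apply: hat_inj => k; rewrite hat_sact !hatZ hat_sact. Qed.

(** The signed basis vectors: conjugate indices give opposite vectors. Over the integers they make
    up the orbit of [mu]. *)
Definition evec (K : nzRingType) n (k : 'I_(n + n)) : 'rV[K]_n :=
  \row_i ((k == lshift n i)%:R - (k == rev_ord (lshift n i))%:R).

Section EvecTheory.
Variables (K : nzRingType) (n : nat).
Implicit Types (k l : 'I_(n + n)).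

Lemma hat_evec k l :
  hat (evec K k) l = (k == l)%:R - (k == rev_ord l)%:R.
Proof.
by elim/half_ind: l => i; rewrite ?hat_rev hat_lshift mxE // rev_ordK opprB.
Qed.

Lemma evec_rev k : evec K (rev_ord k) = - evec K k.
Proof.
by apply: hat_inj => l; rewrite hatN !hat_evec opprB (inj_eq rev_ord_inj) eq_revL.
Qed.

Lemma evec_lshift i : evec K (lshift n i) = delta_mx 0 i.
Proof.
apply/rowP => j; rewrite !mxE eqxx /= (inj_eq (@lshift_inj _ _)).
by rewrite [_ == rev_ord _]eq_sym rev_lshift_neq subr0 eq_sym.
Qed.

Lemma sact_evec (s : sstar n) k : sact s (evec K k) = evec K (sgval s k).
Proof.
apply: hat_inj => l; rewrite hat_sact !hat_evec -sgvalV_rev.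
by congr (_%:R - _%:R); rewrite -(inj_eq (@perm_inj _ (sgval s))) permKV.
Qed.

Lemma evec_sign k : exists (b : bool) i, evec K k = (-1) ^+ b *: delta_mx 0 i /\
  k = (if b then rev_ord (lshift n i) else lshift n i).
Proof.
elim/half_ind: k => i; [exists false | exists true]; exists i.
  by rewrite scale1r evec_lshift.
by rewrite evec_rev scaleN1r evec_lshift.
Qed.

End EvecTheory.

(** * Roots and reflections *)

Section Dot.
Variables (R : realType) (n : nat).
Implicit Types (x y z : 'rV[R]_n).

Lemma dotC x y : dot x y = dot y x.
Proof. by apply: eq_bigr => i _; rewrite mulrC. Qed.

Lemma dotDr x y z : dot x (y + z) = dot x y + dot x z.
Proof. by rewrite /dot -big_split; apply: eq_bigr => i _; rewrite mxE mulrDr. Qed.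

Lemma dotZr x y (c : R) : dot x (c *: y) = c * dot x y.
Proof.
by rewrite /dot mulr_sumr; apply: eq_bigr => i _; rewrite mxE mulrCA.
Qed.

Lemma dotNr x y : dot x (- y) = - dot x y.
Proof. by rewrite -scaleN1r dotZr mulN1r. Qed.

Lemma dotBr x y z : dot x (y - z) = dot x y - dot x z.
Proof. by rewrite dotDr dotNr. Qed.

Lemma dotDl x y z : dot (y + z) x = dot y x + dot z x.
Proof. by rewrite ![dot _ x]dotC dotDr. Qed.

Lemma dotNl x y : dot (- y) x = - dot y x.
Proof. by rewrite ![dot _ x]dotC dotNr. Qed.

Lemma dotBl x y z : dot (y - z) x = dot y x - dot z x.
Proof. by rewrite dotDl dotNl. Qed.

Lemma dotZl x y (c : R) : dot (c *: y) x = c * dot y x.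
Proof. by rewrite ![dot _ x]dotC dotZr. Qed.

Lemma dot0r x : dot x 0 = 0.
Proof. by rewrite -(scale0r x) dotZr mul0r. Qed.

Lemma dot_ge0 x : 0 <= dot x x.
Proof. by apply: sumr_ge0 => i _; rewrite -expr2 sqr_ge0. Qed.

Lemma dot_eq0 x : dot x x = 0 -> x = 0.
Proof.
move=> /eqP; rewrite psumr_eq0; last by move=> i _; rewrite -expr2 sqr_ge0.
by move=> /allP h; apply/rowP => i; have := h i;
  rewrite mem_index_enum mulf_eq0 orbb mxE => /(_ isT)/eqP.
Qed.

Lemma dot_evec k x : dot (evec R k) x = hat x k.
Proof.
have dl i y : dot (evec R (lshift n i)) y = hat y (lshift n i).
  rewrite evec_lshift hat_lshift /dot (bigD1 i) //= !mxE !eqxx mul1r big1 ?addr0 //.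
  by move=> j /negPf ji; rewrite !mxE ji andbF mul0r.
by elim/half_ind: k => i //; rewrite evec_rev hat_rev dotNl dl.
Qed.

Lemma dot_hat x y : dot x y *+ 2 = \sum_k hat x k * hat y k.
Proof.
rewrite sum_half; last by move=> k; rewrite !hat_rev mulrNN.
by congr (_ *+ 2); apply: eq_bigr => i _; rewrite !hat_lshift.
Qed.

Lemma dot_sact (s : sstar n) x y : dot (sact s x) (sact s y) = dot x y.
Proof.
apply: (@mulIf _ (2 : R)); first by rewrite pnatr_eq0.
rewrite !mulr_natr !dot_hat (reindex_inj (@perm_inj _ (sgval s))).
by apply: eq_bigr => k _; rewrite !hat_sact permK.
Qed.

(** Since conjugate indices give opposite vectors, the four sign patterns of a long root take a
    single form. *)
Lemma long_rootsP (al : 'rV[R]_n) : long_roots al <->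
  exists a b : 'I_(n + n), [/\ b != a, b != rev_ord a & al = evec R a - evec R b].
Proof.
split.
  move=> [i [j [b [b' [ij ->]]]]].
  have nij : (lshift n j == lshift n i) = false.
    by rewrite (inj_eq (@lshift_inj _ _)); apply/eqP => e; rewrite e ltnn in ij.
  have ev (b0 : bool) i0 : (-1) ^+ b0 *: delta_mx 0 i0 =
      evec R (if b0 then rev_ord (lshift n i0) else lshift n i0).
    by case: b0; rewrite ?scale1r ?scaleN1r ?evec_rev evec_lshift.
  rewrite !ev -[evec R (if b' then _ else _)]opprK -evec_rev.
  exists (if b then rev_ord (lshift n i) else lshift n i).
  exists (rev_ord (if b' then rev_ord (lshift n j) else lshift n j)).
  split => //.
    by case: b b' => [] []; rewrite ?eq_revL ?rev_ordK ?nij ?rev_lshift_neq //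
      eq_sym rev_lshift_neq.
  by rewrite (inj_eq rev_ord_inj); case: b b' => [] [];
    rewrite ?(inj_eq rev_ord_inj) ?nij ?rev_lshift_neq // eq_sym rev_lshift_neq.
move=> [a [b [ba bra ->]]]; rewrite -evec_rev.
have [c [i [-> ea]]] := evec_sign R a.
have [c' [j [-> eb]]] := evec_sign R (rev_ord b).
have ij : i != j.
  apply/eqP => ij; move: ba bra; rewrite -!(inj_eq rev_ord_inj b) eb ea ij rev_ordK.
  by case: c c' {ea eb} => [] []; rewrite ?rev_ordK !eqxx.
have [lij|lji|/val_inj e] := ltngtP i j; last by rewrite e eqxx in ij.
  by exists i, j, c, c'.
by exists j, i, c', c; rewrite addrC.
Qed.

End Dot.
(** The linear part of the reflection in e_a - e_b. For [b] distinct from [a] and its conjugate it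
    is a product of two transpositions, hence even; [flip] is a single transposition, hence odd. *)
Definition swap_perm n (a b : 'I_(n + n)) : 'S_(n + n) :=
  (tperm a b * tperm (rev_ord a) (rev_ord b))%g.

Definition swap n (a b : 'I_(n + n)) : sstar n := subg _ (swap_perm a b).

Definition flip n (a : 'I_(n + n)) : sstar n := subg _ (tperm a (rev_ord a)).

Section SwapFlip.
Variable n : nat.
Implicit Types (a b k : 'I_(n + n)).

Lemma swap_permE a b k : b != a -> b != rev_ord a ->
  swap_perm a b k = if k == a then b else if k == b then a
    else if k == rev_ord a then rev_ord b
    else if k == rev_ord b then rev_ord a else k.
Proof.
move=> ba bra.
have rab : rev_ord b != a by rewrite eq_revL.
rewrite permM; have [->|->|/eqP ka /eqP kb] := tpermP a b k.
- by rewrite eqxx tpermD ?rev_ord_neq // eq_sym.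
- by rewrite (negPf ba) eqxx tpermD ?rev_ord_neq.
rewrite (negPf ka) (negPf kb); case: tpermP => [->|->|/eqP/negPf-> /eqP/negPf->] //.
  by rewrite eqxx.
by rewrite (inj_eq rev_ord_inj) (negPf ba) eqxx.
Qed.

Lemma swap_perm_Sstar a b : b != a -> b != rev_ord a ->
  swap_perm a b \in Sstar n.
Proof.
move=> ba bra; have rab : rev_ord b != a by rewrite eq_revL.
apply/SstarP => k; rewrite !swap_permE // !eq_revL !rev_ordK.
have [ka|ka] := eqVneq k a; first by rewrite ka [a == rev_ord b]eq_sym (negPf
  rab) eq_sym rev_ord_neq.
have [kb|kb] := eqVneq k b; first by rewrite kb (negPf bra) eq_sym rev_ord_neq.
have [kra|kra] := eqVneq k (rev_ord a); first by rewrite rev_ordK.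
by have [krb|//] := eqVneq k (rev_ord b); rewrite rev_ordK.
Qed.

Lemma swapE a b k : b != a -> b != rev_ord a ->
  sgval (swap a b) k = if k == a then b else if k == b then a
    else if k == rev_ord a then rev_ord b
    else if k == rev_ord b then rev_ord a else k.
Proof. by move=> ba bra; rewrite subgK ?swap_perm_Sstar // swap_permE. Qed.

Lemma swapK a b : b != a -> b != rev_ord a -> involutive (sgval (swap a b)).
Proof.
move=> ba bra k; have rab : rev_ord b != a by rewrite eq_revL.
rewrite !swapE //; have [->|ka] := eqVneq k a; first by rewrite eqxx (negPf ba).
have [->|kb] := eqVneq k b; first by rewrite eqxx.
have [->|kra] := eqVneq k (rev_ord a).
  by rewrite (negPf rab) rev_ord_neq (inj_eq rev_ord_inj) (negPf ba) eqxx.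
have [->|krb] := eqVneq k (rev_ord b).
  by rewrite rev_ord_neq eq_revL [_ == rev_ord b]eq_sym (negPf rab) eqxx.
by rewrite (negPf ka) (negPf kb) (negPf kra) (negPf krb).
Qed.

Lemma swapV a b k : b != a -> b != rev_ord a ->
  (sgval (swap a b))^-1%g k = sgval (swap a b) k.
Proof.
by move=> ba bra; apply: (@perm_inj _ (sgval (swap a b))); rewrite permKV swapK.
Qed.

Lemma swap_Scirc a b : b != a -> b != rev_ord a -> swap a b \in Scirc n.
Proof.
move=> ba bra; rewrite inE subgK ?swap_perm_Sstar // odd_permM !odd_tperm.
by rewrite (inj_eq rev_ord_inj) eq_sym ba.
Qed.

Lemma flip_perm_Sstar a : tperm a (rev_ord a) \in Sstar n.
Proof.
apply/SstarP => k; case: (tpermP a _ k) => [->|->|/eqP ka /eqP kra].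
- by rewrite tpermR rev_ordK.
- by rewrite rev_ordK tpermL.
by rewrite tpermD // eq_sym ?eq_revL ?rev_ordK //.
Qed.

Lemma flipE a k : sgval (flip a) k = tperm a (rev_ord a) k.
Proof. by rewrite subgK ?flip_perm_Sstar. Qed.

Lemma flipV a k : (sgval (flip a))^-1%g k = tperm a (rev_ord a) k.
Proof. by rewrite subgK ?flip_perm_Sstar ?tpermV. Qed.

Lemma flip_odd a : flip a \notin Scirc n.
Proof.
by rewrite inE subgK ?flip_perm_Sstar // odd_tperm eq_sym rev_ord_neq.
Qed.

Lemma sstar_eq (s t : sstar n) : (forall k, sgval s k = sgval t k) -> s = t.
Proof. by move=> e; apply: val_inj; apply/permP. Qed.

Lemma hat_pairroot (K : nzRingType) a b k : b != a -> b != rev_ord a ->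
  hat (evec K a - evec K b) k = if k == a then 1 else if k == b then -1
    else if k == rev_ord a then -1 else if k == rev_ord b then 1 else 0.
Proof.
move=> ba bra; have rab : rev_ord b != a by rewrite eq_revL.
rewrite hatB !hat_evec ![_ == rev_ord k]eq_sym !eq_revL ![_ == k]eq_sym.
have [ka|ka] := eqVneq k a.
  by rewrite ka [a == rev_ord a]eq_sym rev_ord_neq [a == b]eq_sym (negPf ba)
    eq_sym (negPf rab) !subr0.
have [kb|kb] := eqVneq k b.
  by rewrite kb (negPf bra) eq_sym rev_ord_neq !(subr0, sub0r).
have [kra|kra] := eqVneq k (rev_ord a).
  by rewrite kra (inj_eq rev_ord_inj) eq_sym (negPf ba) !(subr0, sub0r).
by have [krb|krb] := eqVneq k (rev_ord b); rewrite !(subr0, sub0r) ?opprK ?oppr0.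
Qed.

End SwapFlip.

Definition long_refl n (a b : 'I_(n + n)) (d : int) : iwahori n :=
  Iwahori ((evec int a - evec int b) *~ d) (swap a b).

(** The factor 2 is there because the coroot of e_a is 2 e_a. *)
Definition short_refl n (a : 'I_(n + n)) (d : int) : iwahori n :=
  Iwahori (evec int a *~ (2 * d)) (flip a).

Definition acts_as_reflection (R : realType) n (t : iwahori n)
    (al : 'rV[R]_n) (d : int) :=
  forall x, aff_act t x = hyperplane_reflection al d x.

Lemma hat_mulrz n (x : 'rV[int]_n) d k : hat (x *~ d) k = hat x k * d.
Proof.
case: d => m; rewrite ?NegzE ?mulrNz ?hatN -!pmulrn hat_mulrn.
  by rewrite -mulr_natr natz.
by rewrite mulrN -mulr_natr natz.
Qed.

Section Reflections.
Variables (R : realType) (n : nat).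
Implicit Types (a b k : 'I_(n + n)).

Lemma dot_pairroot a b (x : 'rV[R]_n) :
  dot (evec R a - evec R b) x = hat x a - hat x b.
Proof. by rewrite dotBl !dot_evec. Qed.

Lemma dot_pairroot2 a b : b != a -> b != rev_ord a ->
  dot (evec R a - evec R b) (evec R a - evec R b) = 2.
Proof.
move=> ba bra; rewrite dot_pairroot !hat_pairroot // !eqxx (negPf ba).
by rewrite opprK.
Qed.

Lemma long_reflP a b d : b != a -> b != rev_ord a ->
  acts_as_reflection (long_refl a b d) (evec R a - evec R b) d.
Proof.
move=> ba bra x; apply: hat_inj => k; have rab : rev_ord b != a by rewrite eq_revL.
rewrite hat_aff /hyperplane_reflection hatB hatZ dot_pairroot2 // dot_pairroot.
rewrite [2 * _ / _]mulrAC divff ?pnatr_eq0 // mul1r.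
rewrite /= hat_mulrz rmorphM /= swapV // swapE // !hat_pairroot //.
have [->|ka] := eqVneq k a; first by rewrite mul1r mulr1; ring.
have [->|kb] := eqVneq k b; first by rewrite rmorphN /=; ring.
have [->|kra] := eqVneq k (rev_ord a); first by rewrite rmorphN /= !hat_rev; ring.
have [->|krb] := eqVneq k (rev_ord b); first by rewrite /= !hat_rev; ring.
by rewrite mul0r mulr0 add0r subr0.
Qed.

Lemma dot_evec2 a : dot (evec R a) (evec R a) = 1.
Proof. by rewrite dot_evec hat_evec eqxx eq_sym rev_ord_neq subr0. Qed.

Lemma short_reflP a d : acts_as_reflection (short_refl a d) (evec R a) d.
Proof.
move=> x; apply: hat_inj => k.
rewrite hat_aff /hyperplane_reflection hatB hatZ dot_evec2 dot_evec divr1.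
rewrite /= hat_mulrz !rmorphM /= flipV !hat_evec [a == rev_ord k]eq_sym eq_revL.
have [->|->|/eqP ka /eqP kra] := tpermP.
- by rewrite eqxx eq_sym rev_ord_neq !subr0 hat_rev rmorph1 /=; ring.
- by rewrite eq_sym rev_ord_neq eqxx !sub0r hat_rev rmorphN rmorph1 /=; ring.
by rewrite eq_sym (negPf ka) (negPf kra) !subrr mul0r mulr0 add0r subr0.
Qed.

End Reflections.

(** * The affine Weyl group *)

(** Twice the l^1-norm, since each entry occurs with both signs; in this form invariance under
    signed permutations is a reindexing. *)
Definition hat_norm (K : numDomainType) n (x : 'rV[K]_n) : K := \sum_k `|hat x k|.

Lemma hat_norm_sact (K : numDomainType) n (s : sstar n) (x : 'rV[K]_n) :
  hat_norm (sact s x) = hat_norm x.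
Proof.
rewrite /hat_norm (reindex_inj (@perm_inj _ (sgval s))).
by apply: eq_bigr => k _; rewrite hat_sact permK.
Qed.

Lemma hat_normE (K : numDomainType) n (x : 'rV[K]_n) :
  hat_norm x = (\sum_i `|x 0 i|) *+ 2.
Proof.
rewrite /hat_norm sum_half => [|k]; last by rewrite hat_rev normrN.
by congr (_ *+ 2); apply: eq_bigr => i _; rewrite hat_lshift.
Qed.

(** Absolute values keep the parity and make its invariance under signed permutations visible. *)
Lemma coroot_latticeE n (v : 'rV[int]_n) :
  coroot_lattice v = (2 %| \sum_i `|v 0 i|)%Z.
Proof.
rewrite /coroot_lattice /=; congr is_true.
by elim/big_ind2: _ => // x x1 y y1 e e1; lia.
Qed.

Lemma coroot_lattice_sact n (s : sstar n) v :
  coroot_lattice (sact s v) = coroot_lattice v.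
Proof.
by move/eqP: (hat_norm_sact s v); rewrite !coroot_latticeE !hat_normE eqr_pMn2r
  // => /eqP ->.
Qed.

Lemma coroot_latticeD n (v w : 'rV[int]_n) :
  coroot_lattice v -> coroot_lattice w -> coroot_lattice (v + w).
Proof.
rewrite /coroot_lattice /= => dv dw.
under eq_bigr do rewrite mxE.
by rewrite big_split rpredD.
Qed.

Lemma coroot_latticeN n (v : 'rV[int]_n) :
  coroot_lattice v -> coroot_lattice (- v).
Proof.
rewrite /coroot_lattice /= => dv.
under eq_bigr do rewrite mxE.
by rewrite sumrN rpredN.
Qed.

Lemma sum_evec n (k : 'I_(n + n)) : exists2 e : int, \sum_i evec int k 0 i = e &
  e = 1 \/ e = - 1.
Proof.
have [b [i [-> _]]] := evec_sign int k; exists ((-1) ^+ b); last by case: b; auto.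
rewrite (bigD1 i) //= !mxE !eqxx mulr1 big1 ?addr0 //.
by move=> j /negPf ji; rewrite !mxE ji andbF mulr0.
Qed.

Section AffineWeyl.
Variables (c : orthogonal_type) (n : nat).
Implicit Types (s t : sstar n) (u w : iwahori n).

Lemma finite_weylM s t : finite_weyl c s -> finite_weyl c t -> finite_weyl c (s *
  t)%g.
Proof.
case: c => //=; rewrite !inE => /negPf hs /negPf ht.
by rewrite odd_permM hs ht.
Qed.

Lemma finite_weylV s : finite_weyl c s -> finite_weyl c s^-1%g.
Proof. by case: c => //=; rewrite !inE odd_permV. Qed.

Lemma finite_weyl1 : finite_weyl c (1%g : sstar n).
Proof. by case: c => //=; rewrite inE odd_perm1. Qed.

Lemma affine_weylM u w : affine_weyl c u -> affine_weyl c w -> affine_weyl c (u *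
  w)%g.
Proof.
move=> [tu su] [tw sw]; split; last exact: finite_weylM.
by apply: coroot_latticeD; rewrite // coroot_lattice_sact.
Qed.

Lemma affine_weylV u : affine_weyl c u -> affine_weyl c u^-1%g.
Proof.
move=> [tu su]; split; last exact: finite_weylV.
by apply: coroot_latticeN; rewrite coroot_lattice_sact.
Qed.

Lemma affine_weyl1 : affine_weyl c (1%g : iwahori n).
Proof.
split; last exact: finite_weyl1.
by rewrite /coroot_lattice /= big1 // => i _; rewrite mxE.
Qed.

Lemma affine_weyl_long_refl a b d : b != a -> b != rev_ord a ->
  affine_weyl c (@long_refl n a b d).
Proof.
move=> ba bra; split; last by have := swap_Scirc ba bra; case: c.
have [e ea] := sum_evec a; have [e' eb] := sum_evec b.
rewrite /coroot_lattice /=.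
have -> : \sum_i ((evec int a - evec int b) *~ d) 0 i = (e - e') * d.
  rewrite -ea -eb -sumrB mulr_suml; apply: eq_bigr => i _.
  by rewrite -!hat_lshift hat_mulrz hatB.
by move=> [] -> [] ->; lia.
Qed.

Lemma affine_weyl_short_refl a d : affine_weyl OddOrthogonal (@short_refl n a d).
Proof.
split => //; rewrite /coroot_lattice /=.
have -> : \sum_i (evec int a *~ (2 * d)) 0 i = (\sum_i evec int a 0 i) * d * 2.
  rewrite -mulrA [d * 2]mulrC mulr_suml; apply: eq_bigr => i _.
  by rewrite -!hat_lshift hat_mulrz.
by lia.
Qed.

End AffineWeyl.

Lemma translationM n (v w : 'rV[int]_n) :
  (translation v * translation w)%g = translation (v + w).
Proof. by congr Iwahori; rewrite ?sact1 // mulg1. Qed.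

Lemma translationV n (v : 'rV[int]_n) : (translation v)^-1%g = translation (- v).
Proof. by congr Iwahori; rewrite invg1 ?sact1. Qed.
(** * The base alcove *)

Lemma dot_continuous (R : realType) n (al : 'rV[R]_n) : continuous (dot al).
Proof.
have aux (s : seq 'I_n) : continuous (fun y : 'rV[R]_n =>
  \sum_(j <- s) al 0 j * y 0 j); last first.
  exact: (aux (index_enum _)).
elim: s => [|i s IH].
  have -> : (fun y : 'rV[R]_n => \sum_(j <- [::]) al 0 j * y 0 j) = cst 0.
    by apply/funext => y; rewrite big_nil.
  exact: cst_continuous.
have -> : (fun y : 'rV[R]_n => \sum_(j <- i :: s) al 0 j * y 0 j) =
    (fun y => al 0 i * y 0 i + \sum_(j <- s) al 0 j * y 0 j).
  by apply/funext => y; rewrite big_cons.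
move=> x; have F : Filter (nbhs (x : 'rV[R]_n)) by exact: nbhs_filter.
apply: cvgD; last exact: IH.
by apply: cvgMl_tmp; exact: coord_continuous.
Qed.
Lemma line_continuous (R : realType) n (y v : 'rV[R]_n) :
  continuous (fun t : R => y + t *: v).
Proof.
move=> t; apply: cvgD; first exact: cvg_cst.
by apply: cvgZr_tmp; exact: cvg_id.
Qed.

Lemma line_closure (R : realType) n (A : set 'rV[R]_n) (y v : 'rV[R]_n) :
  (forall t, 0 < t -> t <= 1 -> A (y + t *: v)) -> closure A y.
Proof.
move=> Av B By.
have := @line_continuous R n y v 0 B; rewrite scale0r addr0 => /(_ By) /nbhs_ballP.
move=> [e /= e0 eB]; exists (y + (Num.min (e / 2) 1) *: v).
have m0 : 0 < Num.min (e / 2) 1 by rewrite lt_min ltr01 andbT; lra.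
split; first by apply: Av; rewrite // ge_min lexx orbT.
apply: eB; rewrite /ball /= sub0r normrN gtr0_norm //.
by rewrite gt_min; apply/orP; left; lra.
Qed.

Definition aff (R : realType) n (al : 'rV[R]_n) (d : int) (x : 'rV[R]_n) : R :=
  dot al x - d%:~R.

(** The vector (n, ..., 1): its 2n coordinates n, ..., 1, -1, ..., -n are nonzero and pairwise
    distinct. *)
Definition rho n : 'rV[int]_n := \row_i (n%:Z - i%:Z).

(* The denominator exceeds the absolute value of any difference of two of the
   2n coordinates of [rho], so that no affine root vanishes on the orbit. *)
Definition base_point (R : realType) n : 'rV[R]_n :=
  (n + n).+1%:R^-1 *: map_mx intr (rho n).

Lemma hat_rho n k : hat (rho n) k =
  if (k < n)%N then n%:Z - k%:Z else n%:Z - 1 - k%:Z.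
Proof.
elim/half_ind: k => i; rewrite ?hat_rev hat_lshift mxE /=.
  by rewrite ltn_ord.
by have := ltn_ord i; case: ifP; lia.
Qed.

Lemma hat_rho_inj n k l : hat (rho n) k = hat (rho n) l -> k = l.
Proof.
rewrite !hat_rho => h; apply: val_inj => /=; move: h.
have := ltn_ord k; have := ltn_ord l.
by do 2 case: ifP; lia.
Qed.

Lemma hat_base_point (R : realType) n k :
  hat (base_point R n) k = (hat (rho n) k)%:~R / (n + n).+1%:R.
Proof. by rewrite hatZ hat_map mulrC. Qed.

(** Used with m = 2n+1 to separate the translation part of a coordinate of [w p] from the
    contribution of [rho]. *)
Lemma small_multiple (q r : int) (m : nat) :
  `|r| < m%:Z -> q * m%:Z + r = 0 -> q = 0 /\ r = 0.
Proof.
move=> rm e; have q0 : q = 0 by nia.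
by move: e; rewrite q0; lia.
Qed.

Lemma hat_rho_bound n k : 0 < `|hat (rho n) k| <= n%:Z.
Proof. by rewrite hat_rho; have := ltn_ord k; case: ifP; lia. Qed.

Section Roots.
Variables (R : realType) (c : orthogonal_type) (n : nat).
Implicit Types (al : 'rV[R]_n) (d : int) (x y : 'rV[R]_n) (w g t : iwahori n).

Lemma root_systemP al : root_system c al <->
  (exists a b : 'I_(n + n), [/\ b != a, b != rev_ord a & al = evec R a - evec R b])
  \/ (c = OddOrthogonal /\ exists a : 'I_(n + n), al = evec R a).
Proof.
have sP : short_roots al <-> exists a : 'I_(n + n), al = evec R a.
  split=> [[i [b ->]]|[a ->]]; last first.
    by have [b [i [-> _]]] := evec_sign R a; exists i, b.
  exists (if b then rev_ord (lshift n i) else lshift n i).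
  by case: b; rewrite ?evec_rev evec_lshift ?scaleN1r ?scale1r.
case: c => /=.
  split; first by move=> /long_rootsP; left.
  by move=> [/long_rootsP // | []].
split=> [[/sP|/long_rootsP]|[/long_rootsP|[_ /sP]]]; by [right|left|right|left].
Qed.

Lemma root_sact s al : root_system c al -> root_system c (sact s al).
Proof.
move=> /root_systemP h; apply/root_systemP.
case: h => [[a [b [ba bra ->]]]|[-> [a ->]]].
  left; exists (sgval s a), (sgval s b); split.
  - by rewrite (inj_eq (@perm_inj _ _)).
  - by rewrite -sgval_rev (inj_eq (@perm_inj _ _)).
  - by rewrite sactD sactN !sact_evec.
by right; split => //; exists (sgval s a); rewrite sact_evec.
Qed.

Lemma root_dot_gt0 al : root_system c al -> 0 < dot al al.
Proof.
move=> /root_systemP [[a [b [ba bra ->]]]|[_ [a ->]]].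
  by rewrite dot_pairroot2.
by rewrite dot_evec2.
Qed.

Lemma root_dot_int al (v : 'rV[int]_n) : root_system c al ->
  exists z : int, dot al (map_mx intr v) = z%:~R.
Proof.
move=> /root_systemP [[a [b [ba bra ->]]]|[_ [a ->]]].
  by exists (hat v a - hat v b); rewrite dot_pairroot !hat_map rmorphB.
by exists (hat v a); rewrite dot_evec hat_map.
Qed.

Lemma root_reflection al d : root_system c al ->
  exists2 t : iwahori n, affine_weyl c t & acts_as_reflection t al d.
Proof.
move=> /root_systemP [[a [b [ba bra ->]]]|[-> [a ->]]].
  exists (long_refl a b d); [exact: affine_weyl_long_refl | exact: long_reflP].
exists (short_refl a d); [exact: affine_weyl_short_refl | exact: short_reflP].
Qed.

(** Roots are integral on the lattice, so the group permutes the affine roots; questions about [w A]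
    thereby become questions about [A]. *)
Lemma aff_pullback w al d : root_system c al -> exists al' d',
  [/\ root_system c al', al' = sact (spart w)^-1%g al
    & forall x, aff al' d' x = aff al d (aff_act w x)].
Proof.
move=> ral; have [z ez] := root_dot_int (tpart w) ral.
exists (sact (spart w)^-1%g al), (d - z); split => //; first exact: root_sact.
move=> x; rewrite /aff /aff_act dotDr ez -{2}[al]sact1 -[in RHS](mulVg (spart w)).
by rewrite sactM dot_sact rmorphB /=; ring.
Qed.

Lemma aff_base_point_neq0 w al d : root_system c al ->
  aff al d (aff_act w (base_point R n)) != 0.
Proof.
have M0 : (n + n).+1%:R != 0 :> R by rewrite pnatr_eq0.
move=> /root_systemP [[a [b [ba bra ->]]]|[_ [a ->]]].
  rewrite /aff dot_pairroot !hat_aff !hat_base_point.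
  set k := ((sgval (spart w))^-1%g a); set l := ((sgval (spart w))^-1%g b).
  have kl : l != k by rewrite (inj_eq (@perm_inj _ _)).
  set z := (hat (tpart w) a - hat (tpart w) b - d) * (n + n).+1%:Z
    + (hat (rho n) k - hat (rho n) l).
  apply: contra_neq kl => e; suff : hat (rho n) l = hat (rho n) k by apply:
    hat_rho_inj.
  have : z = 0.
    apply/eqP; rewrite -(intr_eq0 R) /z !(rmorphD, rmorphM, rmorphN) /=.
    rewrite -[X in _ == X](mul0r (n + n).+1%:R) -e; apply/eqP.
    by rewrite -pmulrn; field.
  have := hat_rho_bound k; have := hat_rho_bound l => bl bk.
  by move=> /small_multiple []; lia.
rewrite /aff dot_evec hat_aff hat_base_point; set k := ((sgval (spart w))^-1%g a).
set z := (hat (tpart w) a - d) * (n + n).+1%:Z + hat (rho n) k.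
apply/eqP => e; have : z = 0.
  apply/eqP; rewrite -(intr_eq0 R) /z !(rmorphD, rmorphM, rmorphN) /=.
  rewrite -[X in _ == X](mul0r (n + n).+1%:R) -e; apply/eqP.
  by rewrite -pmulrn; field.
have := hat_rho_bound k => bk.
by move=> /small_multiple []; lia.
Qed.

End Roots.
(** A concrete model of the base alcove, which the definition only provides through a choice; see
    [base_alcoveE]. *)
Definition region (R : realType) c n : set 'rV[R]_n :=
  [set x | forall al d, root_system c al ->
     0 < aff al d (base_point R n) * aff al d x].
Arguments region R c n : clear implicits.

(* [f] is the integral form of the functional: its value at the integral
   vector [X] is [2n + 1] times the value of [al - d] at [X / (2n + 1)]. The
   last functional is needed only for D_2, whose affine diagram is not
   connected. *)
Inductive simple_affine (R : realType) c n :
    'rV[R]_n -> int -> ('rV[int]_n -> int) -> Prop :=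
| SimpleStep (i j : 'I_n) of j = i.+1 :> nat :
    simple_affine c (evec R (lshift n i) - evec R (lshift n j)) 0
      (fun X => X 0 i - X 0 j)
| SimpleEven (i j : 'I_n) of i.+2 = n & j.+1 = n & c = EvenOrthogonal :
    simple_affine c (evec R (lshift n i) - evec R (rev_ord (lshift n j))) 0
      (fun X => X 0 i + X 0 j)
| SimpleOdd (i : 'I_n) of i.+1 = n & c = OddOrthogonal :
    simple_affine c (evec R (lshift n i)) 0 (fun X => X 0 i)
| SimpleTop (i j : 'I_n) of i = 0%N :> nat & j = 1%N :> nat :
    simple_affine c (evec R (rev_ord (lshift n i)) - evec R (lshift n j)) (-1)
      (fun X => (n + n).+1%:Z - X 0 i - X 0 j)
| SimpleTop2 (i j : 'I_n) of i = 0%N :> nat & j = 1%N :> nat & n = 2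
    & c = EvenOrthogonal :
    simple_affine c
      (evec R (rev_ord (lshift n i)) - evec R (rev_ord (lshift n j))) (-1)
      (fun X => (n + n).+1%:Z - X 0 i + X 0 j).

Lemma pos_mul_trans (R : realType) (x y z : R) :
  0 < x * y -> 0 < y * z -> 0 < x * z.
Proof.
move=> xy yz; have : 0 < (x * y) * (y * z) by apply: mulr_gt0.
have -> : (x * y) * (y * z) = (x * z) * (y * y) by ring.
have yy : 0 < y * y by rewrite -expr2 exprn_even_gt0 //=; apply: contraTneq xy =>
  ->; rewrite mulr0 ltxx.
by rewrite pmulr_lgt0.
Qed.

Lemma near_zero_same_sign (R : realType) (x y : R) (d : int) :
  0 < x < 1 /\ 0 < y < 1 \/ -1 < x < 0 /\ -1 < y < 0 ->
  0 < (x - d%:~R) * (y - d%:~R).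
Proof.
have [d0|d1|->] := ltrgt0P d; last by rewrite subr0; nra.
  have : (1 : R) <= d%:~R by rewrite ler1z; lia.
  by nra.
have : d%:~R <= (-1 : R) by rewrite -[X in _ <= X]/((-1)%:~R) ler_int; lia.
by nra.
Qed.

Section Alcove.
Variables (R : realType) (c : orthogonal_type) (n : nat).
Hypothesis hn : (2 <= n)%N.
Implicit Types (al : 'rV[R]_n) (d : int) (x y : 'rV[R]_n) (w g t : iwahori n).
Local Notation p := (base_point R n).
Local Notation M := ((n + n).+1%:R : R).

Lemma simple_affine_scaled al d f (X : 'rV[int]_n) : simple_affine c al d f ->
  aff al d (M^-1 *: map_mx intr X) = (f X)%:~R / M.
Proof.
have M0 : M != 0 by rewrite pnatr_eq0.
case=> [i j _|i j _ _ _|i _ _|i j _ _|i j _ _ _ _]; rewrite /aff;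
  rewrite ?dot_pairroot ?dot_evec ?hat_rev ?hat_lshift !mxE ?subr0;
  rewrite ?(rmorphD, rmorphN) /= -?pmulrn; by field.
Qed.

Lemma simple_affine_root al d f : simple_affine c al d f -> root_system c al.
Proof.
have lne (i j : 'I_n) : (i : nat) != j -> lshift n i != lshift n j.
  by move=> ij; rewrite (inj_eq (@lshift_inj _ _)).
case=> [i j e|i j e e' ec|i e ec|i j e e'|i j e e' _ _]; apply/root_systemP;
  try (left; eexists; eexists; split; [| |by []]);
  try first [ by rewrite rev_lshift_neq | by rewrite eq_sym rev_lshift_neq
    | by apply: lne; lia | by rewrite (inj_eq rev_ord_inj); apply: lne; lia
    | by rewrite rev_ordK; apply: lne; lia ].
- by right; split => //; exists (lshift n i).
- by rewrite rev_ordK rev_lshift_neq.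
Qed.

Lemma simple_roots_affine al : simple_roots c al -> exists f, simple_affine c al
  0 f.
Proof.
rewrite /simple_roots /last_simple_root => -[[i [j [ij ->]]]|].
  by rewrite -!evec_lshift; eexists; apply: SimpleStep.
case: c => [[i [j [ei ej ->]]]|[i ei ->]].
  by rewrite -!evec_lshift -[evec R (lshift n j)]opprK -evec_rev; eexists;
    apply: SimpleEven.
by rewrite -evec_lshift; eexists; apply: SimpleOdd.
Qed.

(** Under these bounds each root takes all its values in (0, 1) or all of them in (-1, 0). No
    integral level separates two such points, so that finitely many inequalities define [region]. In
    the even case the last coordinate may be negative. *)
Definition coord_bounds x :=
  [/\ forall i j : 'I_n, (i < j)%N -> 0 < x 0 i - x 0 j < 1,
      forall i j : 'I_n, i != j -> 0 < x 0 i + x 0 j < 1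
    & c = OddOrthogonal -> forall i, 0 < x 0 i < 1].

Lemma simple_affine_coord_bounds x :
  (forall al d f, simple_affine c al d f -> 0 < aff al d x) -> coord_bounds x.
Proof.
move=> sx.
have step (i j : 'I_n) : j = i.+1 :> nat -> x 0 j < x 0 i.
  by move=> /(SimpleStep R c)/sx; rewrite /aff dot_pairroot !hat_lshift subr0
    subr_gt0.
have mono (i j : 'I_n) : (i < j)%N -> x 0 j < x 0 i.
  case: j => j jn /=; elim: j jn => // j IH jn.
  rewrite ltnS leq_eqVlt => /orP[/eqP e|ij]; first by apply: step; rewrite /= e.
  have jn' : (j < n)%N by lia.
  by apply: lt_trans (IH jn' ij); apply: step.
have monoW (i j : 'I_n) : (i <= j)%N -> x 0 j <= x 0 i.
  by rewrite leq_eqVlt => /orP[/eqP/val_inj->//|/mono/ltW].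
pose i0 := Ordinal (ltnW hn); pose i1 := Ordinal hn.
have top : x 0 i0 + x 0 i1 < 1.
  have := sx _ _ _ (@SimpleTop R c n i0 i1 erefl erefl).
  rewrite /aff dot_pairroot hat_rev !hat_lshift; lra.
have n1 : (n.-1 < n)%N by lia.
have n2 : (n.-2 < n)%N by lia.
pose l1 := Ordinal n1; pose l2 := Ordinal n2.
have odd_pos : c = OddOrthogonal -> forall i, 0 < x 0 i.
  move=> ec i; apply: (@lt_le_trans _ _ (x 0 l1)); last by apply: monoW => /=;
    have := ltn_ord i; lia.
  have e : l1.+1 = n by rewrite /=; lia.
  by have := sx _ _ _ (@SimpleOdd R c n l1 e ec);
    rewrite /aff dot_evec hat_lshift subr0.
have sum_pos' (i j : 'I_n) : (i < j)%N -> 0 < x 0 i + x 0 j.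
  case ec : c => ij; last by rewrite addr_gt0 ?odd_pos.
  have e1 : l1.+1 = n by rewrite /=; lia.
  have e2 : l2.+2 = n by rewrite /=; lia.
  have := sx _ _ _ (@SimpleEven R c n l2 l1 e2 e1 ec).
  rewrite /aff dot_pairroot hat_rev !hat_lshift.
  have : x 0 l2 <= x 0 i by apply: monoW => /=; have := ltn_ord j; lia.
  have : x 0 l1 <= x 0 j by apply: monoW => /=; have := ltn_ord j; lia.
  lra.
have sum_pos (i j : 'I_n) : i != j -> 0 < x 0 i + x 0 j.
  move=> ij; have [/sum_pos'//|/sum_pos'|/val_inj e] := ltngtP i j;
    first by rewrite addrC.
  by rewrite e eqxx in ij.
have sum_lt' (i j : 'I_n) : (i < j)%N -> x 0 i + x 0 j < 1.
  move=> ij; have : x 0 i <= x 0 i0 by apply: monoW.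
  have : x 0 j <= x 0 i1 by apply: monoW => /=; lia.
  lra.
split.
- move=> i j ij; rewrite subr_gt0 mono //=.
  have xi : x 0 i <= x 0 i0 by apply: monoW.
  have [j1|j1] := eqVneq (j : nat) 1%N; last first.
    have : 0 < x 0 i1 + x 0 j by apply: sum_pos'; rewrite /=; lia.
    lra.
  have -> : j = i1 by apply: val_inj.
  suff : x 0 i0 - x 0 i1 < 1 by lra.
  case ec : c; last by have := odd_pos ec i1; lra.
  (* For n > 2 the next coordinate is less than that of [i1] and has a positive sum with it, so the
     coordinate of [i1] is positive. For n = 2 it may be negative, and the bound is the extra
     functional. *)
  have [en|nn] := eqVneq n 2.
    have := sx _ _ _ (@SimpleTop2 R c n i0 i1 erefl erefl en ec).
    rewrite /aff dot_pairroot !hat_rev !hat_lshift; lra.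
  have n3 : (2 < n)%N by lia.
  have : 0 < x 0 i1 + x 0 (Ordinal n3) by apply: sum_pos'.
  have : x 0 (Ordinal n3) < x 0 i1 by apply: mono.
  lra.
- move=> i j ij; rewrite sum_pos //=.
  have [/sum_lt'//|/sum_lt'|/val_inj e] := ltngtP i j; first by rewrite addrC.
  by rewrite e eqxx in ij.
- move=> ec i; rewrite odd_pos //=.
  have : x 0 i <= x 0 i0 by apply: monoW.
  have := odd_pos ec i1; lra.
Qed.

Lemma simple_affine_rho al d f : simple_affine c al d f -> 1 <= f (rho n).
Proof.
by case=> [i j e|i j e e' ec|i e ec|i j e e'|i j e e' _ _]; rewrite !mxE; lia.
Qed.

Lemma simple_affine_base_point al d f : simple_affine c al d f -> 0 < aff al d p.
Proof.
move=> sa; rewrite (simple_affine_scaled _ sa) divr_gt0 ?ltr0n // ltr0z.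
by have := simple_affine_rho sa; lia.
Qed.

Lemma coord_bounds_root x al : coord_bounds x -> root_system c al ->
  (forall y, coord_bounds y -> 0 < dot al x < 1 /\ 0 < dot al y < 1 \/
     -1 < dot al x < 0 /\ -1 < dot al y < 0).
Proof.
move=> bx ral y [] => by1 by2 by3; case: bx => bx1 bx2 bx3.
move: ral => /root_systemP [[a [b [ba bra ->]]]|[ec [a ->]]];
  rewrite ?dot_pairroot ?dot_evec.
  elim/half_ind: a ba bra => i; elim/half_ind: b => j;
    rewrite ?rev_ordK ?hat_rev !hat_lshift => ba bra.
  - have [ij|ij|/val_inj e] := ltngtP i j; last by rewrite e eqxx in ba.
      by left; rewrite bx1 ?by1.
    by right; have := bx1 _ _ ij; have := by1 _ _ ij; lra.
  - have ij : i != j by apply: contra_neq bra => ->.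
    by left; rewrite !opprK bx2 ?by2.
  - have ij : i != j by apply: contra_neq bra => ->.
    by right; have := bx2 _ _ ij; have := by2 _ _ ij; lra.
  - have [ij|ij|/val_inj e] := ltngtP i j; last by rewrite e eqxx in ba.
      by right; have := bx1 _ _ ij; have := by1 _ _ ij; lra.
    by left; have := bx1 _ _ ij; have := by1 _ _ ij; lra.
elim/half_ind: a => i; rewrite ?hat_rev !hat_lshift.
  by left; rewrite bx3 ?by3.
by right; have := bx3 ec i; have := by3 ec i; lra.
Qed.

Lemma coord_bounds_region x : coord_bounds x -> region R c n x.
Proof.
move=> bx al d ral; apply: near_zero_same_sign.
apply: coord_bounds_root => //; apply: simple_affine_coord_bounds.
exact: simple_affine_base_point.
Qed.

Lemma region_simple_affine x : region R c n x <->
  forall al d f, simple_affine c al d f -> 0 < aff al d x.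
Proof.
split=> [rx al d f sa|sx]; last exact/coord_bounds_region/simple_affine_coord_bounds.
have := rx _ d (simple_affine_root sa).
by rewrite pmulr_rgt0 // (simple_affine_base_point sa).
Qed.

Lemma region_base_point : region R c n p.
Proof. by apply/region_simple_affine => al d f /simple_affine_base_point. Qed.

Lemma affDZ al d x y (s : R) : aff al d (x + s *: (y - x)) =
  (1 - s) * aff al d x + s * aff al d y.
Proof. by rewrite /aff dotDr dotZr dotBr; ring. Qed.

Lemma region_regular : region R c n `<=` @regular_points R c n.
Proof.
move=> x rx [al [d [ral hx]]]; have := rx _ d ral.
by rewrite /aff hx subrr mulr0 ltxx.
Qed.

Lemma region_connected : connected (region R c n).
Proof.
have -> : region R c n =
    \bigcup_(y in region R c n) [set p + s *: (y - p) | s in `[0, 1]].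
  apply/seteqP; split=> [y ry|y [z rz [s s01 <-]]].
    exists y => //; exists 1; last by rewrite scale1r addrC subrK.
    by rewrite /= in_itv /= ler01 lexx.
  move: s01; rewrite /= in_itv /= => /andP[s0 s1].
  apply/region_simple_affine => al d f sa; rewrite affDZ.
  have pp := simple_affine_base_point sa.
  have pz := (region_simple_affine z).1 rz _ _ _ sa.
  have [->|s0'] := eqVneq s 0; first by rewrite subr0 mul1r mul0r addr0.
  apply: ltr_wpDl; first by apply: mulr_ge0; [rewrite subr_ge0|exact: ltW].
  by apply: mulr_gt0 => //; rewrite lt_def s0'.
apply: bigcup_connected.
  exists p => y ry; exists 0; last by rewrite scale0r addr0.
  by rewrite /= in_itv /= ler01 lexx.
move=> y _; apply: connected_continuous_connected; first exact: segment_connected.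
by apply: continuous_subspaceT; exact: line_continuous.
Qed.

Lemma component_same_side al d x y : root_system c al ->
  connected_component (@regular_points R c n) x y -> 0 < aff al d x * aff al d y.
Proof.
move=> ral [C [Cx Creg Cconn] Cy].
have nz z : C z -> aff al d z != 0.
  by move=> /Creg Cz; apply/eqP => e; apply: Cz; exists al, d; split => //;
    apply/eqP; rewrite -subr_eq0; apply/eqP.
have : is_interval (dot al @` C).
  apply/connected_intervalP/connected_continuous_connected => //.
  by apply: continuous_subspaceT; exact: dot_continuous.
move=> itv; have [//|le] := ltP 0 (aff al d x * aff al d y).
have lt0 : aff al d x * aff al d y < 0 by rewrite lt_neqAle le mulf_neq0 ?nz.
suff [z Cz ez] : (dot al @` C) d%:~R by have := nz _ Cz; rewrite /aff ez subrr eqxx.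
have [xd|dx] := ltP (aff al d x) 0.
  apply: (itv (dot al x) (dot al y)); [by exists x | by exists y|].
  by move: xd lt0; rewrite /aff; nra.
apply: (itv (dot al y) (dot al x)); [by exists y | by exists x|].
by move: dx lt0; rewrite /aff; nra.
Qed.

Lemma region_component x : region R c n x ->
  connected_component (@regular_points R c n) x = region R c n.
Proof.
move=> rx; apply/seteqP; split=> [y xy al d ral|].
  by apply: (pos_mul_trans (rx _ d ral)); apply: component_same_side.
by apply: connected_component_max => //; [exact: region_regular | exact:
  region_connected].
Qed.

(** Because of [get], existence is shown for [region]; any other alcove with the defining property
    is then recognized by one of its points near the origin. *)
Lemma base_alcoveE : @base_alcove R c n = region R c n.
Proof.
have H : exists A : set 'rV[R]_n, [/\ alcove c A, A `<=` @positive_chamber R c n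
  & closure A 0].
  exists (region R c n); split.
  - by exists p; [exact/region_regular/region_base_point | rewrite
    region_component //; exact: region_base_point].
  - move=> x rx al /simple_roots_affine [f sa].
    by have := (region_simple_affine x).1 rx _ _ _ sa; rewrite /aff subr0.
  - apply: (@line_closure _ _ _ _ p) => s s0 s1; rewrite add0r.
    apply: coord_bounds_region.
    have [b1 b2 b3] := simple_affine_coord_bounds simple_affine_base_point.
    have e i : (s *: p) 0 i = s * p 0 i by rewrite mxE.
    by split=> [i j ij|i j ij|ec i]; rewrite !e;
      [have := b1 _ _ ij | have := b2 _ _ ij | have := b3 ec i];
      move: s0 s1; nra.
rewrite /base_alcove; have [[x regx ->] pos clo] := getPex H.
(* Entries below 1/4 in absolute value make the functionals of level -1 positive; the linear ones
   are positive on the chamber. *)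
have [|y [xy yb]] := clo (ball 0 (4^-1)); first exact: nbhsx_ballx.
rewrite (same_connected_component xy) region_component //.
have small i : `|y 0 i| < 4^-1.
  by case: yb => _ /(_ 0 i); rewrite /ball /= mxE sub0r normrN.
apply/region_simple_affine => al d f sa.
have simple : simple_roots c al -> d = 0 -> 0 < aff al d y.
  by move=> sal ->; rewrite /aff subr0; apply: pos.
move: simple; case: sa => [i j e|i j e e' ec|i e ec|i j e e'|i j e e' _ _].
- by apply=> //; left; exists i, j; rewrite !evec_lshift.
- apply=> //; right; rewrite ec; exists i, j; split => //.
  by rewrite evec_rev opprK !evec_lshift.
- by apply=> //; right; rewrite ec; exists i => //; rewrite evec_lshift.
- move=> _; rewrite /aff dot_pairroot hat_rev !hat_lshift.
  by have := small i; have := small j; rewrite !ltr_norml; lra.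
- move=> _; rewrite /aff dot_pairroot !hat_rev !hat_lshift.
  by have := small i; have := small j; rewrite !ltr_norml; lra.
Qed.

End Alcove.

(** * Walls of the base alcove *)

Lemma simple_affine_facet (R : realType) c n (al : 'rV[R]_n) d f :
  (2 <= n)%N -> simple_affine c al d f ->
  exists X : 'rV[int]_n, f X = 0 /\ forall al' d' f',
    simple_affine c al' d' f' -> 1 <= f' X \/ (al' = al /\ d' = d).
Proof.
(* The first four witnesses are [rho] with one entry changed so that the functional vanishes. The
   last case is D_2, where 2n+1 = 5 and the witness is (3, -2). *)
move=> hn; case=> [i j e|i j e e' ec|i e ec|i j e e'|i j e e' en ec].
- exists (\row_m (n%:Z - m%:Z - ((m : nat) == i)%:Z)); split.
    by rewrite !mxE; lia.
  move=> al' d' f' [i' j' e1|i' j' e1 e2 _|i' e1 _|i' j' e1 e2|i' j' e1 e2 _ _];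
    rewrite ?mxE.
  + have [ii|/eqP ii] := eqVneq (i' : nat) i; last by left; rewrite ?mxE; lia.
    have -> : i' = i by apply: val_inj.
    have -> : j' = j by apply: val_inj; rewrite /= e1 ii.
    by right.
  + by left; rewrite ?mxE; have := ltn_ord j; lia.
  + by left; rewrite ?mxE; have := ltn_ord j; lia.
  + by left; rewrite ?mxE; lia.
  + by left; rewrite ?mxE; lia.
- exists (\row_m (n%:Z - m%:Z - 3 * ((m : nat) == j)%:Z)); split.
    by rewrite !mxE; lia.
  move=> al' d' f' [i' j' e1|i' j' e1 e2 _|i' e1 ec'|i' j' e1 e2|i' j' e1 e2 _
    _]; rewrite ?mxE.
  + by left; rewrite ?mxE; have := ltn_ord j'; lia.
  + have -> : i' = i by apply: val_inj => /=; lia.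
    have -> : j' = j by apply: val_inj => /=; lia.
    by right.
  + by rewrite ec in ec'.
  + by left; rewrite ?mxE; lia.
  + by left; rewrite ?mxE; lia.
- exists (\row_m (n%:Z - m%:Z - ((m : nat) == i)%:Z)); split.
    by rewrite !mxE; lia.
  move=> al' d' f' [i' j' e1|i' j' e1 e2 ec'|i' e1 ec'|i' j' e1 e2|i' j' e1 e2 _
    ec']; rewrite ?mxE.
  + by left; rewrite ?mxE; have := ltn_ord j'; lia.
  + by rewrite ec in ec'.
  + have -> : i' = i by apply: val_inj => /=; lia.
    by right.
  + by left; rewrite ?mxE; lia.
  + by rewrite ec in ec'.
- exists (\row_m (n%:Z - m%:Z + 2 * ((m : nat) == i)%:Z)); split.
    by rewrite !mxE; lia.
  move=> al' d' f' [i' j' e1|i' j' e1 e2 ec'|i' e1 ec'|i' j' e1 e2|i' j' e1 e2 _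
    ec']; rewrite ?mxE.
  + by left; rewrite ?mxE; have := ltn_ord j'; lia.
  + by left; rewrite ?mxE; lia.
  + by left; rewrite ?mxE; lia.
  + have -> : i' = i by apply: val_inj => /=; lia.
    have -> : j' = j by apply: val_inj => /=; lia.
    by right.
  + by left; rewrite ?mxE; lia.
- exists (\row_m (3 - 5 * ((m : nat) == j)%:Z)); split.
    by rewrite !mxE; lia.
  move=> al' d' f' [i' j' e1|i' j' e1 e2 ec'|i' e1 ec'|i' j' e1 e2|i' j' e1 e2 _
    ec']; rewrite ?mxE.
  + by left; rewrite ?mxE; have := ltn_ord j'; lia.
  + by left; rewrite ?mxE; lia.
  + by rewrite ec in ec'.
  + by left; rewrite ?mxE; lia.
  + have -> : i' = i by apply: val_inj => /=; lia.
    have -> : j' = j by apply: val_inj => /=; lia.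
    by right.
Qed.

Lemma hat_le_norm (K : numDomainType) n (x : 'rV[K]_n) k : `|hat x k| <= hat_norm x.
Proof.
by rewrite /hat_norm (bigD1 k) //= lerDl sumr_ge0.
Qed.

Lemma root_dot_le (R : realType) c n (al z : 'rV[R]_n) : root_system c al ->
  `|dot al z| <= 2 * hat_norm z.
Proof.
move=> /root_systemP [[a [b [_ _ ->]]]|[_ [a ->]]]; rewrite ?dot_pairroot ?dot_evec.
  by have := ler_normB (hat z a) (hat z b); have := hat_le_norm z a;
    have := hat_le_norm z b; lra.
by have := hat_le_norm z a; have := normr_ge0 (hat z a); lra.
Qed.

Section Walls.
Variables (R : realType) (c : orthogonal_type) (n : nat).
Hypothesis hn : (2 <= n)%N.
Implicit Types (al : 'rV[R]_n) (d : int) (x y : 'rV[R]_n) (w g t : iwahori n).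
Local Notation p := (base_point R n).
Local Notation M := ((n + n).+1%:R : R).

Lemma closed_region_segment y :
  (forall al d f, simple_affine c al d f -> 0 <= aff al d y) ->
  forall s, 0 < s -> s <= 1 -> region R c n (y + s *: (p - y)).
Proof.
move=> sy s s0 s1; apply/region_simple_affine => // al d f sa.
rewrite affDZ; apply: ltr_wpDl.
  by apply: mulr_ge0; [rewrite subr_ge0 | exact: sy sa].
by apply: mulr_gt0 => //; apply: simple_affine_base_point sa.
Qed.

(** The segment from [y] to [p] lies in the region except possibly at [y]. An affine root with
    opposite strict signs at its ends would vanish inside the region. *)
Lemma closed_region_same_side al d y : root_system c al ->
  (forall al d f, simple_affine c al d f -> 0 <= aff al d y) ->
  0 <= aff al d p * aff al d y.
Proof.
move=> ral sy.
have pp : 0 < aff al d p * aff al d p by exact: (@region_base_point R c n hn al d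
  ral).
rewrite leNgt; apply/negP => neg.
set u := aff al d p * aff al d p in pp; set v := aff al d p * aff al d y in neg.
have s0 : 0 < - v / (u - v) by apply: divr_gt0; lra.
have s1 : - v / (u - v) <= 1 by rewrite ler_pdivrMr; lra.
have seg := closed_region_segment sy s0 s1; have := seg al d ral.
rewrite affDZ mulrDr !(mulrCA (aff al d p)) -/u -/v.
have -> : (1 - - v / (u - v)) * v + - v / (u - v) * u = 0 by field; lra.
by rewrite ltxx.
Qed.

(** Suppose that a second hyperplane, of [al'], passes through the facet point [x]. Moving [x]
    slightly along the part [z] of [al'] orthogonal to [al] stays in the closed region, yet crosses
    that hyperplane unless [z] is 0. *)
Lemma simple_affine_wall al d f : simple_affine c al d f ->
  wall c (@base_alcove R c n) al d.
Proof.
move=> sa; split; first exact: (simple_affine_root hn sa).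
have [X [fX hX]] := simple_affine_facet hn sa.
have M0 : 0 < M by rewrite ltr0n.
set x := M^-1 *: map_mx intr X : 'rV[R]_n.
have fx : aff al d x = 0 by rewrite (simple_affine_scaled _ sa) fX mul0r.
have gx al' d' f' : simple_affine c al' d' f' -> M^-1 <= aff al' d' x \/ (al' =
  al /\ d' = d).
  move=> sa'; have [le|] := hX _ _ _ sa'; [left | by right].
  by rewrite (simple_affine_scaled _ sa') ler_pdivlMr // mulVf ?gt_eqF // ler1z.
exists x; split.
- rewrite base_alcoveE //; apply: (@line_closure _ _ _ _ (p - x)).
  apply: closed_region_segment => al' d' f' /gx [le|[-> ->]].
    by apply: le_trans le; rewrite invr_ge0 ltW.
  by rewrite fx.
- by apply/eqP; rewrite -subr_eq0; apply/eqP.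
move=> al' d' ral' hx'.
have fx' : aff al' d' x = 0 by rewrite /aff hx' subrr.
have al0 := root_dot_gt0 (simple_affine_root hn sa).
set k := dot al' al / dot al al; set z := al' - k *: al.
have alz : dot al z = 0.
  by rewrite dotBr dotZr /k divfK ?gt_eqF // dotC subrr.
have al'z : dot al' z = dot z z.
  by rewrite /z dotBl dotZl -/z alz mulr0 subr0.
(* The sign of [q] directs the move away from the side of [p]. *)
set q := aff al' d' p.
have q0 : q != 0.
  by have := @region_base_point R c n hn _ d' ral'; rewrite -/q;
    apply: contraTneq => ->; rewrite mulr0 ltxx.
(* The other simple functionals are at least 1/(2n+1) at [x]; the move by e q z changes each by at
   most e |q| 2 [hat_norm z], which is at most 1/(2n+1) for e = 1/((2n+1) C). *)
set C := 1 + `|q| * (2 * hat_norm z).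
have C1 : 1 <= C by rewrite lerDl !mulr_ge0 // /hat_norm sumr_ge0.
set e := (M * C)^-1.
have MC0 : 0 < M * C by apply: mulr_gt0 => //; lra.
have e0 : 0 < e by rewrite invr_gt0.
have yE bt b : aff bt b (x - (e * q) *: z) = aff bt b x - e * (q * dot bt z).
  by rewrite /aff dotBr (dotZr bt z) -mulrA addrAC.
have : 0 <= q * aff al' d' (x - (e * q) *: z).
  apply: closed_region_same_side => // bt b g sb.
  rewrite yE; have [le|[-> ->]] := gx _ _ _ sb; last by rewrite fx alz !mulr0 subrr.
  rewrite subr_ge0; apply: le_trans le.
  rewrite /e invfM -mulrA -[leRHS]mulr1; apply: ler_wpM2l;
    first by rewrite invr_ge0 ltW.
  rewrite mulrC ler_pdivrMr ?mul1r; last lra.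
  apply: le_trans (ler_norm _) _; rewrite normrM.
  have := ler_wpM2l (normr_ge0 q) (root_dot_le z (simple_affine_root hn sb)).
  by rewrite /C; lra.
rewrite yE fx' sub0r al'z mulrN oppr_ge0 => le.
have z0 : z = 0.
  apply: dot_eq0; apply/eqP; rewrite eq_le dot_ge0 andbT.
  have qq : 0 < e * (q * q) by apply: mulr_gt0 => //; rewrite -expr2 exprn_even_gt0.
  by rewrite -(pmulr_rle0 _ qq); apply: le_trans le; rewrite le_eqVlt; apply/orP;
    left; apply/eqP; ring.
have al'E : al' = k *: al by apply/eqP; rewrite -subr_eq0 -/z z0.
have k0 : k != 0.
  by have := root_dot_gt0 ral'; apply: contraTneq => k0;
    rewrite al'E k0 scale0r dot0r ltxx.
have d'E : d'%:~R = k * d%:~R :> R.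
  by move: fx fx'; rewrite /aff al'E dotZl => /eqP; rewrite subr_eq0 =>
    /eqP -> /eqP; rewrite subr_eq0 => /eqP.
apply/seteqP; split=> y; rewrite /hyperplane /= al'E dotZl d'E.
  by apply: mulfI.
by move=> ->.
Qed.

End Walls.
(** * Generation by simple reflections *)

Section Generation.
Variables (R : realType) (c : orthogonal_type) (n : nat).
Implicit Types (al : 'rV[R]_n) (d : int) (x y : 'rV[R]_n) (w g t u : iwahori n).
Local Notation p := (base_point R n).
Local Notation M := ((n + n).+1%:R : R).

Let M0 : M != 0. Proof. by rewrite pnatr_eq0. Qed.

(** Reflecting [x] brings it closer to [y] if the hyperplane separates them, and moves it away if
    they lie strictly on one side. The first effect gives generation by simple reflections, the
    second the end of the raising process. *)
Lemma dist_reflection t al d x y : root_system c al ->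
  acts_as_reflection t al d ->
  dot (aff_act t x - y) (aff_act t x - y) =
  dot (x - y) (x - y) + 4 / dot al al * (aff al d x * aff al d y).
Proof.
move=> ral ->; have al0 := root_dot_gt0 ral.
rewrite /hyperplane_reflection -/(aff al d x) addrAC.
set k := _ / _; set v := x - y.
have e : dot al v = aff al d x - aff al d y by rewrite /v dotBr opprB addrA subrK.
clearbody v; rewrite dotBr !dotBl !dotZl !dotZr [dot v al]dotC e /k.
by field; rewrite gt_eqF.
Qed.

Lemma aff_base_pointE w : aff_act w p =
  M^-1 *: map_mx intr (tpart w *~ (n + n).+1 + sact (spart w) (rho n)).
Proof.
apply: hat_inj => k; rewrite hat_aff hat_base_point hatZ hat_map hatD hat_mulrz
  hat_sact.
by rewrite rmorphD rmorphM /= -pmulrn; field.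
Qed.

(** Integrality turns descent and ascent of the distance into induction on natural numbers. *)
Lemma dist_base_point_nat w : exists N : nat,
  dot (aff_act w p - p) (aff_act w p - p) * M ^+ 2 = N%:R.
Proof.
set z := tpart w *~ (n + n).+1 + sact (spart w) (rho n) - rho n.
exists (\sum_i `|z 0%R i| ^ 2)%N.
have -> : aff_act w p - p = M^-1 *: map_mx intr z.
  by rewrite aff_base_pointE -scalerBr -map_mxB.
rewrite dotZl dotZr; set D := dot _ _.
have -> : M^-1 * (M^-1 * D) * M ^+ 2 = D by field.
rewrite /D natr_sum; apply: eq_bigr => i _; rewrite !mxE -rmorphM /=.
by rewrite pmulrn; congr (_%:~R); lia.
Qed.

Lemma base_point_fixed w : aff_act w p = p -> w = 1%g.
Proof.
case: w => v s e.
have key k : hat v k = 0 /\ (sgval s)^-1%g k = k.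
  have : hat v k * (n + n).+1%:Z + (hat (rho n) ((sgval s)^-1%g k) - hat (rho n)
    k) = 0.
    have : hat (aff_act (Iwahori v s) p) k = hat p k by rewrite e.
    rewrite hat_aff !hat_base_point /= => /eqP; rewrite eq_sym -subr_eq =>
      /eqP/esym ek.
    apply/eqP; rewrite -(intr_eq0 R) rmorphD rmorphB rmorphM /= -pmulrn ek.
    by apply/eqP; field.
  have := hat_rho_bound k; have := hat_rho_bound ((sgval s)^-1%g k) => b1 b2.
  move=> /small_multiple [|-> e0]; first by lia.
  by split => //; apply: hat_rho_inj; lia.
congr Iwahori; first by apply: hat_inj => k; rewrite hat0; case: (key k).
by apply: sstar_eq => k; rewrite perm1 -{1}(key k).2 permKV.
Qed.

Lemma base_point_faithful u w : aff_act u p = aff_act w p -> u = w.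
Proof.
move=> e; apply: (mulgI u^-1%g); rewrite mulVg; apply/esym/base_point_fixed.
by rewrite aff_actM -e -aff_actM mulVg /aff_act sact1 map_mx0 add0r.
Qed.

Hypothesis hn : (2 <= n)%N.

(** Freeness of the action on alcoves. Scaled by 2n+1, the image of [p] is [Q], a multiple of 2n+1
    plus a signed permutation of [rho]. The alcove inequalities, with a parity argument at the first
    entry, make the translation part vanish; they then order the entries, so that only the sign of
    the last one is open. *)
Lemma affine_weyl_region w : affine_weyl c w -> region R c n (aff_act w p) ->
  w = 1%g.
Proof.
move=> [even_w weyl_w] rw; apply: base_point_fixed.
have Mgt0 : 0 < M by rewrite ltr0n.
set Q := tpart w *~ (n + n).+1 + sact (spart w) (rho n).
have QE : aff_act w p = M^-1 *: map_mx intr Q by exact: aff_base_pointE.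
have Qi i : (aff_act w p) 0 i = (Q 0 i)%:~R / M by rewrite QE !mxE mulrC.
have [b1 b2 b3] := simple_affine_coord_bounds hn ((region_simple_affine c hn _).1
  rw).
have toZ (z : int) : 0 < z%:~R / M < 1 -> 0 < z < (n + n).+1%:Z.
  rewrite pmulr_lgt0 ?invr_gt0 // ltr0z => /andP[-> ].
  by rewrite ltr_pdivrMr // mul1r pmulrn ltr_int.
have Q1 (i j : 'I_n) : (i < j)%N -> 0 < Q 0 i - Q 0 j < (n + n).+1%:Z.
  by move=> /b1; rewrite !Qi -mulrBl -rmorphB => /toZ.
have Q2 (i j : 'I_n) : i != j -> 0 < Q 0 i + Q 0 j < (n + n).+1%:Z.
  by move=> /b2; rewrite !Qi -mulrDl -rmorphD => /toZ.
pose i0 := Ordinal (ltnW hn); pose i1 := Ordinal hn.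
pose r (i : 'I_n) := hat (rho n) ((sgval (spart w))^-1%g (lshift n i)).
have rb i : 0 < `|r i| <= n%:Z by exact: hat_rho_bound.
have Qr i : Q 0 i = tpart w 0 i * (n + n).+1%:Z + r i.
  by rewrite -!hat_lshift hatD hat_mulrz hat_sact.
clearbody Q.
have nu1 (i : 'I_n) : (0 < i)%N -> tpart w 0 i = 0.
  move=> i_gt0; have ne : i0 != i by apply: contraTneq i_gt0 => <-.
  have := Q1 i0 i i_gt0; have := Q2 _ _ ne => q2 q1.
  have : tpart w 0 i * (n + n).+1%:Z + (r i - Q 0 i) = 0 by rewrite Qr; ring.
  by have := rb i => rbi; move=> /small_multiple [] //; lia.
(* The inequalities alone leave 0 and 1; the coroot lattice excludes 1. *)
have nu0 : tpart w 0 i0 = 0.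
  have /dvdzP [q qE] : (2 %| tpart w 0%R i0)%Z.
    move: even_w; rewrite /coroot_lattice /= (bigD1 i0) //= big1 ?addr0 // => i ii0.
    by apply: nu1; rewrite lt0n; apply: contra_neq ii0 => e; apply: val_inj.
  have := Q1 i0 i1 isT; have := Q2 i0 i1 isT; rewrite Qr qE.
  by have := rb i0; have := rb i1; nia.
have Qb i : 0 < `|Q 0 i| <= n%:Z.
  rewrite Qr; suff -> : tpart w 0 i = 0 by rewrite mul0r add0r.
  have [e|i_gt0] := posnP i; last exact: nu1.
  by rewrite (_ : i = i0) //; apply: val_inj.
have decr (i j : 'I_n) : (i < j)%N -> `|Q 0 j| < Q 0 i.
  move=> ij; have ne : i != j by apply: contraTneq ij => ->; rewrite ltnn.
  by have := Q1 _ _ ij; have := Q2 _ _ ne; lia.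
(* The absolute values are n strictly decreasing integers between 1 and n, which leaves no
   freedom. *)
have up (i : 'I_n) : Q 0 i <= n%:Z - i%:Z.
  case: i => m; elim: m => [|m IH] mn; first by have := Qb (Ordinal mn);
    rewrite /=; lia.
  have := decr (Ordinal (ltnW mn)) (Ordinal mn) (leqnn _).
  by have := IH (ltnW mn); rewrite /=; lia.
have lo k (i : 'I_n) : (k + i.+1 = n)%N -> n%:Z - i%:Z <= `|Q 0 i|.
  elim: k i => [|k IH] i e; first by have := Qb i; lia.
  have i1n : (i.+1 < n)%N by lia.
  have := IH (Ordinal i1n); rewrite /= => /(_ ltac:(lia)).
  move: (decr i (Ordinal i1n) (leqnn _)); move: (Q 0 (Ordinal i1n)) (Q 0 i) =>
    a b; lia.
have QE1 (i : 'I_n) : (i.+1 < n)%N -> Q 0 i = n%:Z - i%:Z.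
  move=> i1n; have := decr i (Ordinal i1n) (leqnn _); have := up i.
  by have := lo (n - i.+2)%N (Ordinal i1n); rewrite /= => /(_ ltac:(lia)); lia.
have n1 : (n.-1 < n)%N by lia.
have n2 : (n.-2 < n)%N by lia.
pose l1 := Ordinal n1; pose l2 := Ordinal n2.
have last_or (i : 'I_n) : (i.+1 < n)%N \/ i = l1.
  have := ltn_ord i; rewrite leq_eqVlt => /orP[/eqP e|]; last by left.
  by right; apply: val_inj => /=; lia.
have [Q_l1|Q_l1] : Q 0 l1 = 1 \/ Q 0 l1 = - 1.
  have := up l1; have := Qb l1; have := QE1 l2; have := decr l2 l1.
  by rewrite /= => /(_ ltac:(lia)) + /(_ ltac:(lia)); lia.
  rewrite QE; have -> : Q = rho n.
    apply/rowP => i; rewrite [RHS]mxE.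
    by have [/QE1 //|->] := last_or i; rewrite Q_l1 /=; lia.
  by [].
case ec : c weyl_w b3 => weyl_w b3; last first.
  by have := b3 erefl l1; rewrite Qi => /toZ; rewrite Q_l1; lia.
(* What remains is the sign change of the last entry. It is an odd permutation, so the even case
   excludes it. *)
pose F : iwahori n := Iwahori 0 (flip (lshift n l1)).
have : (F * w)%g = 1%g.
  apply: base_point_fixed; rewrite aff_actM; apply/rowP => i.
  rewrite -!hat_lshift hat_aff hat0 add0r flipV hat_base_point hat_lshift.
  case: tpermP => [/(@lshift_inj _ _)->|/esym/eqP|ne _].
  - by rewrite hat_rev hat_lshift Qi Q_l1 -mulNr -rmorphN mxE /=;
    congr (_%:~R / _); lia.
  - by rewrite rev_lshift_neq.
  rewrite hat_lshift Qi QE1 ?mxE //.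
  by have [|e] := last_or i => //; rewrite e in ne.
move=> /(congr1 (fun v => odd_perm (sgval (spart v)))) /=.
rewrite odd_permM odd_perm1; have := flip_odd (lshift n l1); rewrite inE negbK =>
  ->.
by move: weyl_w; rewrite /= inE => /negPf ->.
Qed.

Lemma simple_reflection_step w : ~ region R c n (aff_act w p) ->
  exists2 t, simple_reflections R c t & exists al d, [/\ root_system c al,
    acts_as_reflection t al d & aff al d (aff_act w p) * aff al d p < 0].
Proof.
move=> nr; apply: contrapT => none; apply: nr; apply/region_simple_affine =>
  // al d f sa.
have ral := simple_affine_root hn sa; have pp := simple_affine_base_point hn sa.
have := aff_base_point_neq0 w d ral; case: ltgtP => // neg _; exfalso; apply: none.
have [t wt act] := root_reflection d ral; exists t.
  by split => //; exists al, d; split => //; exact: (simple_affine_wall hn sa).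
by exists al, d; split => //; rewrite nmulr_rlt0.
Qed.

Definition simple_product w := exists2 s : seq (iwahori n),
  (forall g, g \in s -> simple_reflections R c g) & w = (\prod_(g <- s) g)%g.

Lemma simple_productM u w : simple_product u -> simple_product w ->
  simple_product (u * w)%g.
Proof.
move=> [s hs ->] [s' hs' ->]; exists (s ++ s'); last by rewrite big_cat.
by move=> g; rewrite mem_cat => /orP[/hs|/hs'].
Qed.

Lemma simple_product_simple g : simple_reflections R c g -> simple_product g.
Proof.
move=> hg; exists [:: g]; last by rewrite big_seq1.
by move=> h; rewrite inE => /eqP ->.
Qed.

(** While [w p] is outside the region, some wall separates it from [p], and reflecting in that wall
    decreases the distance. *)
Lemma to_region w : exists2 u, simple_product u & region R c n (aff_act (u * w)%g
  p).
Proof.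
have [N] := dist_base_point_nat w; elim/ltn_ind: N w => N IH w eN.
have [r|] := pselect (region R c n (aff_act w p)).
  by exists 1%g; rewrite ?mul1g //; exists [::]; rewrite ?big_nil.
move=> /simple_reflection_step [t st [al [d [ral act neg]]]].
have [N' eN'] := dist_base_point_nat (t * w)%g.
have [|u gu ru] := IH N' _ _ eN'.
  rewrite -(ltr_nat R) -eN -eN' aff_actM (dist_reflection _ _ ral act) ltr_pM2r
    ?exprn_gt0 ?ltr0n //.
  by rewrite -subr_lt0 addrAC subrr add0r pmulr_rlt0 // divr_gt0 // (root_dot_gt0
    ral).
exists (u * t)%g; last by rewrite -mulgA.
by apply: simple_productM => //; exact: simple_product_simple.
Qed.

End Generation.
(** * The exchange condition *)

Lemma aff_act_reflection (R : realType) c n (t : iwahori n) (al : 'rV[R]_n) d x :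
  root_system c al -> acts_as_reflection t al d ->
  aff al d (aff_act t x) = - aff al d x.
Proof.
move=> ral ->; rewrite /hyperplane_reflection -/(aff al d x).
have al0 := root_dot_gt0 ral; rewrite {1}/aff dotBr dotZr.
rewrite [X in _ = - X](_ : _ = dot al x - d%:~R) //.
rewrite divfK ?gt_eqF // /aff; ring.
Qed.

Lemma reflection_involution (R : realType) c n (t : iwahori n) (al : 'rV[R]_n) d :
  root_system c al -> acts_as_reflection t al d -> (t * t)%g = 1%g.
Proof.
move=> ral act; apply: (@base_point_fixed R); rewrite aff_actM act.
rewrite /hyperplane_reflection -/(aff al d (aff_act t _)) (aff_act_reflection _
  ral act).
rewrite act /hyperplane_reflection -/(aff _ _ _) mulrN mulNr scaleNr opprK subrK //.
Qed.

Lemma reflection_conj (R : realType) n (t g : iwahori n) (al al' : 'rV[R]_n) d d' :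
  acts_as_reflection t al d -> al' = sact (spart g)^-1%g al ->
  (forall x, aff al' d' x = aff al d (aff_act g x)) ->
  acts_as_reflection (g^-1 * t * g)%g al' d'.
Proof.
move=> act al'E aff'E x; rewrite -mulgA !aff_actM act /hyperplane_reflection.
rewrite -/(aff al d _) -/(aff al' d' _) -aff'E al'E dot_sact.
rewrite {1}/aff_act -scaleNr sactD addrA -/(aff_act g^-1%g _) -aff_actM mulVg.
by rewrite [aff_act 1%g x]/aff_act map_mx0 add0r sact1 sactZ scaleNr.
Qed.

(** [wall] compares hyperplanes as sets, which determines the root only up to a factor; the
    reflection does not see this factor. *)
Lemma hyperplane_eq_reflection (R : realType) c n (al al' : 'rV[R]_n) d d' :
  root_system c al -> root_system c al' ->
  hyperplane al' d' = hyperplane al d ->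
  hyperplane_reflection al' d' =1 hyperplane_reflection al d.
Proof.
move=> ral ral' e; have al0 := root_dot_gt0 ral; have al'0 := root_dot_gt0 ral'.
pose x0 := (d%:~R / dot al al) *: al.
have x0H : hyperplane al d x0 by rewrite /hyperplane /= dotZr divfK ?gt_eqF.
have x0H' : hyperplane al' d' x0 by rewrite e.
set k := dot al' al / dot al al; pose z := al' - k *: al.
have alz : dot al z = 0 by rewrite dotBr dotZr /k divfK ?gt_eqF // dotC subrr.
have : hyperplane al' d' (x0 + z).
  by rewrite e /hyperplane /= dotDr x0H alz addr0.
rewrite /hyperplane /= dotDr x0H' => /(canRL (addKr _)); rewrite addNr => al'z.
have z0 : z = 0.
  by apply: dot_eq0; rewrite {1}/z dotBl dotZl al'z alz mulr0 subr0.
have al'E : al' = k *: al by apply/eqP; rewrite -subr_eq0 -/z z0.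
have k0 : k != 0.
  by apply: contraTneq al'0 => k0; rewrite al'E k0 scale0r dot0r ltxx.
have d'E : d'%:~R = k * d%:~R :> R by rewrite -x0H' -x0H al'E dotZl.
move=> y; rewrite /hyperplane_reflection d'E al'E !dotZl dotZr scalerA.
by congr (_ - _ *: _); field; rewrite k0 gt_eqF.
Qed.

Section Exchange.
Variables (R : realType) (c : orthogonal_type) (n : nat).
Hypothesis hn : (2 <= n)%N.
Implicit Types (al : 'rV[R]_n) (d : int) (x y : 'rV[R]_n) (w g t u : iwahori n).
Local Notation p := (base_point R n).
Local Notation W := (@affine_weyl c n).
Local Notation S := (@simple_reflections R c n).

Lemma closure_same_side al d x : root_system c al -> closure (region R c n) x ->
  0 <= aff al d p * aff al d x.
Proof.
move=> ral cx; rewrite leNgt; apply/negP => neg.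
have cont : {for x, continuous (fun y => aff al d p * aff al d y)}.
  have F : Filter (nbhs (x : 'rV[R]_n)) by exact: nbhs_filter.
  apply: cvgMl_tmp; apply: cvgB; last exact: cvg_cst.
  exact: dot_continuous.
have [y [ry]] := cx _ (cvgr_lt _ cont _ neg).
by apply/negP; rewrite -leNgt ltW //; apply: ry.
Qed.

Lemma simple_reflectionP g : S g -> exists al d,
  [/\ wall c (region R c n) al d, root_system c al & acts_as_reflection g al d].
Proof.
by move=> [_ [al [d [wl act]]]]; exists al, d; rewrite -base_alcoveE //; split =>
  //; case: wl.
Qed.

Lemma simple_reflection_separates g al d t : S g ->
  root_system c al -> acts_as_reflection t al d ->
  aff al d p * aff al d (aff_act g p) < 0 -> t = g.
Proof.
move=> /simple_reflectionP [bt [b [[_ [x [cx hx uniq]]] rbt actg]]] ral act neg.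
have gx : aff_act g x = x.
  by rewrite actg /hyperplane_reflection hx subrr mulr0 mul0r scale0r subr0.
have [ax0|ax0] := eqVneq (aff al d x) 0.
  have : hyperplane al d = hyperplane bt b.
    by apply: uniq => //; apply/eqP; rewrite -subr_eq0; apply/eqP.
  move=> /(hyperplane_eq_reflection rbt ral) e.
  by apply: (@base_point_faithful R); rewrite act actg e.
have [al' [d' [ral' _ e]]] := aff_pullback g d ral.
have s1 := closure_same_side d ral cx.
have s2 := closure_same_side d' ral' cx.
move: s2; rewrite !e gx => s2.
have kk : 0 < aff al d x ^+ 2 by rewrite exprn_even_gt0.
have := mulr_ge0 s1 s2; rewrite mulrACA -expr2 leNgt; case/negP.
by rewrite nmulr_rlt0.
Qed.

(** Along the gallery of prefixes of [l] the affine root changes sign at some letter. If this is not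
    the first letter, the root pulled back by the first letter separates [p] from its image under
    the remaining product. *)
Lemma exchange l al d t : (forall g, g \in l -> S g) ->
  root_system c al -> acts_as_reflection t al d ->
  aff al d p * aff al d (aff_act (\prod_(g <- l) g)%g p) < 0 ->
  exists l1 s l2, l = l1 ++ s :: l2 /\
    t = ((\prod_(g <- l1) g) * s * (\prod_(g <- l1) g)^-1)%g.
Proof.
elim: l al d t => [|g l IH] al d t hl ral act.
  rewrite big_nil /aff_act map_mx0 add0r sact1 => neg.
  by have := sqr_ge0 (aff al d p); rewrite expr2 leNgt neg.
rewrite big_cons aff_actM => neg.
have Sg : S g by apply: hl; rewrite mem_head.
have [neg'|] := ltP (aff al d p * aff al d (aff_act g p)) 0.
  exists [::], g, l; split => //.
  by rewrite big_nil mul1g invg1 mulg1 (simple_reflection_separates Sg ral act).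
rewrite le_eqVlt => /orP[|pos].
  have nz := aff_base_point_neq0 g d ral.
  have nz1 : aff al d p != 0.
    by have := aff_base_point_neq0 1%g d ral; rewrite /aff_act map_mx0 add0r sact1.
  by rewrite eq_sym mulf_eq0 (negPf nz) (negPf nz1).
have [al' [d' [ral' al'E e]]] := aff_pullback g d ral.
have act' := reflection_conj act al'E e.
have hl' h : h \in l -> S h by move=> hl0; apply: hl; rewrite inE hl0 orbT.
have [|l1 [s [l2 [-> tE]]]] := IH _ _ _ hl' ral' act'.
  by rewrite !e; move: neg pos; set a := aff _ _ _; set b := aff _ _ _;
    set k := aff _ _ _; nra.
exists (g :: l1), s, l2; split => //; rewrite big_cons invgM.
have -> : t = (g * (g^-1 * t * g) * g^-1)%g by rewrite !mulgA mulgV mul1g mulgK.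
by rewrite tE !mulgA.
Qed.

Lemma cox_lengthP w : simple_product R c w -> is_word S (cox_length S w) w /\
  forall j, is_word S j w -> (cox_length S w <= j)%N.
Proof.
move=> [s hs we].
have ex : exists k, `[< is_word S k w >] by exists (size s); apply/asboolP;
  exists s.
have := @getPex _ [set k | is_word S k w /\ (forall j, is_word S j w -> (k <=
  j)%N)].
apply; case: (ex_minnP ex) => k /asboolP wk mk; exists k; split => // j wj.
by apply: mk; apply/asboolP.
Qed.

Lemma simple_mulgg g : S g -> (g * g)%g = 1%g.
Proof. by move=> /simple_reflectionP [al [d [_ ral act]]];
  apply: reflection_involution ral act. Qed.

Lemma reflection_shortens u al d t : simple_product R c u ->
  root_system c al -> acts_as_reflection t al d ->
  aff al d p * aff al d (aff_act u p) < 0 ->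
  (cox_length S (t * u)%g < cox_length S u)%N.
Proof.
move=> gu ral act neg; have [[l [sl hl] uE] _] := cox_lengthP gu.
move: neg; rewrite {1}uE => /(exchange hl ral act) [l1 [s [l2 [lE tE]]]].
have ss : (s * s = 1)%g by apply/simple_mulgg/hl; rewrite lE mem_cat mem_head orbT.
have tuE : (t * u = \prod_(g <- l1 ++ l2) g)%g.
  rewrite uE lE tE !big_cat big_cons /= -!mulgA mulKg.
  by rewrite (mulgA s s) ss mul1g.
have hl' g : g \in l1 ++ l2 -> S g.
  by move=> gl; apply: hl; move: gl; rewrite lE !mem_cat inE => /orP[->|->];
    rewrite ?orbT.
have [_ min] := cox_lengthP (ex_intro2 _ _ (l1 ++ l2) hl' tuE).
have : (cox_length S (t * u)%g <= size (l1 ++ l2))%N by apply: min;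
  exists (l1 ++ l2).
by rewrite -sl lE !size_cat /=; lia.
Qed.

Lemma simple_product_affine_weyl u : simple_product R c u -> W u.
Proof.
move=> [l hl ->]; elim: l hl => [|g l IH] hl; first by rewrite big_nil;
  apply: affine_weyl1.
rewrite big_cons; apply: affine_weylM; first by have [] := hl g (mem_head _ _).
by apply: IH => h hh; apply: hl; rewrite inE hh orbT.
Qed.

Lemma simple_productV u : simple_product R c u -> simple_product R c u^-1%g.
Proof.
move=> [l hl ->]; elim: l hl => [|g l IH] hl.
  by rewrite big_nil invg1; exists [::]; rewrite ?big_nil.
have Sg : S g by apply: hl; rewrite mem_head.
rewrite big_cons invgM; apply: simple_productM.
  by apply: IH => h hh; apply: hl; rewrite inE hh orbT.
suff -> : g^-1%g = g by exact: simple_product_simple.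
by apply: (mulIg g); rewrite mulVg simple_mulgg.
Qed.

Lemma affine_weyl_simple_product w : W w -> simple_product R c w.
Proof.
move=> Ww; have [u gu ru] := to_region R c hn w.
have e : (u * w = 1)%g.
  by apply: affine_weyl_region ru => //; apply: affine_weylM => //;
    apply: simple_product_affine_weyl.
suff -> : w = u^-1%g by exact: simple_productV.
by apply: (mulgI u); rewrite e mulgV.
Qed.

(** The hyperplane of [t] separates [p] from [t p], so exchange applies to a word for [t] itself. *)
Lemma reflection_cox t al d : W t -> root_system c al ->
  acts_as_reflection t al d -> cox_reflection W S t.
Proof.
move=> Wt ral act; have [l hl tE] := affine_weyl_simple_product Wt.
have nz1 : aff al d p != 0.
  by have := aff_base_point_neq0 1%g d ral; rewrite /aff_act map_mx0 add0r sact1.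
have [|l1 [s [l2 [lE e]]]] := exchange hl ral act.
  rewrite -tE (aff_act_reflection _ ral act) mulrN oppr_lt0 -expr2.
  by rewrite exprn_even_gt0.
exists (\prod_(g <- l1) g)%g, s; split => //.
  apply: simple_product_affine_weyl; exists l1 => // g gl1.
  by apply: hl; rewrite lE mem_cat gl1.
by apply: hl; rewrite lE mem_cat mem_head orbT.
Qed.

Lemma bruhat_step_reflection u t al d : W u -> W t -> root_system c al ->
  acts_as_reflection t al d -> 0 < aff al d p * aff al d (aff_act u p) ->
  bruhat_step W S u (t * u)%g.
Proof.
move=> Wu Wt ral act pos; split => //; first by exists t => //;
  exact: reflection_cox act.
have := @reflection_shortens (t * u)%g al d t _ ral act.
rewrite mulgA (reflection_involution ral act) mul1g; apply.
  exact/affine_weyl_simple_product/affine_weylM.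
by rewrite aff_actM (aff_act_reflection _ ral act) mulrN oppr_lt0.
Qed.

Lemma bruhat_step_separates u w : bruhat_step W S u w -> exists t al d,
  [/\ W t, root_system c al, acts_as_reflection t al d, w = (t * u)%g
    & aff al d p * aff al d (aff_act w p) < 0].
Proof.
move=> [Wu [t [g [s [Wg Ss tE]]] wE] lt].
have [bt [b [_ rbt act]]] := simple_reflectionP Ss.
have [al [d [ral alE affE]]] := aff_pullback g^-1%g b rbt.
have act' := reflection_conj act alE affE; rewrite invgK -tE in act'.
have Wt : W t.
  rewrite tE; apply: affine_weylM; last exact: affine_weylV.
  by apply: affine_weylM => //; case: Ss.
exists t, al, d; split => //; rewrite ltNge; apply/negP.
rewrite le_eqVlt => /orP[|pos].
  have nz := aff_base_point_neq0 w d ral.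
  have nz1 : aff al d p != 0.
    by have := aff_base_point_neq0 1%g d ral; rewrite /aff_act map_mx0 add0r sact1.
  by rewrite eq_sym mulf_eq0 (negPf nz) (negPf nz1).
have := @reflection_shortens u al d t (affine_weyl_simple_product Wu) ral act'.
rewrite -wE ltnNge (ltnW lt) => /(_ _)/notF; apply.
by move: pos; rewrite wE aff_actM (aff_act_reflection _ ral act') mulrN oppr_gt0.
Qed.

End Exchange.
(** * Admissible elements are permissible *)

Lemma sum_normr_sact n (s : sstar n) (v : 'rV[int]_n) :
  \sum_i `|sact s v 0 i| = \sum_i `|v 0 i|.
Proof. by move/eqP: (hat_norm_sact s v); rewrite !hat_normE eqr_pMn2r // =>
  /eqP. Qed.

(** Both coordinate sums have the parity of the same sum of absolute values. Hence translations by
    an orbit lie in one class modulo the affine Weyl group. *)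
Lemma coroot_lattice_sactB n (s : sstar n) (v : 'rV[int]_n) :
  coroot_lattice (sact s v - v).
Proof.
have par1 (z : int) : (2 %| z - `|z|)%Z by case: (ger0P z); lia.
have par (x : 'rV[int]_n) : (2 %| \sum_i x 0%R i - \sum_i `|x 0%R i|)%Z.
  by rewrite -sumrB; apply: rpred_sum => i _; exact: par1.
rewrite /coroot_lattice /=.
have -> : \sum_i (sact s v - v) 0 i = \sum_i sact s v 0 i - \sum_i v 0 i.
  by rewrite -sumrB; apply: eq_bigr => i _; rewrite -!hat_lshift hatB.
have := rpredB (par (sact s v)) (par v).
by rewrite sum_normr_sact opprB addrA subrK.
Qed.

Lemma conv_lmodE (K : numDomainType) (V : lmodType K) (k : {i01 K})
    (x y : convex_lmodType V) :
  conv k x y = (y : V) + k%:num *: ((x : V) - (y : V)).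
Proof.
by rewrite /conv /= /unstable.onem scalerBl scale1r scalerBr addrCA.
Qed.

Section Hull.
Variables (R : realType) (c : orthogonal_type) (n : nat) (m : 'rV[int]_n).
Implicit Types (v w : 'rV[R]_n).

Definition orbit_hull : set 'rV[R]_n :=
  convex_hull [set map_mx intr m' | m' in weyl_orbit c m].

Lemma orbit_hull_orbit m' : weyl_orbit c m m' -> orbit_hull (map_mx intr m').
Proof. by move=> om A [_ sA]; apply: sA; exists m'. Qed.

Lemma orbit_hull_segment v w (s : R) : 0 <= s <= 1 ->
  orbit_hull v -> orbit_hull w -> orbit_hull (v + s *: (w - v)).
Proof.
move=> /andP[s0 s1] hv hw A [cA sA]; have Av := hv A (conj cA sA).
have Aw := hw A (conj cA sA).
have := cA w v (Itv01 s0 s1) (mem_set Aw) (mem_set Av); rewrite inE.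
by rewrite conv_lmodE.
Qed.

Lemma orbit_hull_sact s v : finite_weyl c s -> orbit_hull v -> orbit_hull (sact s
  v).
Proof.
move=> ws; suff : orbit_hull `<=` [set v | orbit_hull (sact s v)] by exact.
apply: smallest_sub => [x y k|_ [m' [t wt <-] <-]].
  rewrite !inE /= => hx hy.
  rewrite conv_lmodE sactD sactZ sactD sactN.
  by apply: orbit_hull_segment => //; rewrite ge0 le1.
rewrite /= -map_sact; apply: orbit_hull_orbit.
by exists (t * s)%g; rewrite ?sactM //; exact: finite_weylM.
Qed.

End Hull.

Lemma reflection_linear (R : realType) n (t : iwahori n) (al : 'rV[R]_n) d v :
  acts_as_reflection t al d ->
  sact (spart t) v = v - (2 * dot al v / dot al al) *: al.
Proof.
move=> act; have -> : sact (spart t) v = aff_act t v - aff_act t 0.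
  by rewrite /aff_act sact0 addr0 addrAC subrr add0r.
rewrite !act /hyperplane_reflection dot0r.
have -> : 2 * dot al v / dot al al = 2 * (dot al v - d%:~R) / dot al al
  - 2 * (0 - d%:~R) / dot al al by ring.
move: (2 * (0 - _) / _) (2 * (dot al v - _) / _) => k0 k1.
by rewrite scalerBl sub0r opprK opprB [RHS]addrA [RHS]addrAC.
Qed.

Section Admissible.
Variables (R : realType) (c : orthogonal_type) (n : nat).
Hypothesis hn : (2 <= n)%N.
Local Notation p := (base_point R n).

Lemma aff_act_region_same_side (w : iwahori n) (al x : 'rV[R]_n) d :
  root_system c al -> region R c n x ->
  0 < aff al d (aff_act w p) * aff al d (aff_act w x).
Proof.
by move=> ral rx; have [al' [d' [ral' _ e]]] := aff_pullback w d ral;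
  rewrite -!e; apply: rx.
Qed.

Lemma bruhat_step_hull (m : 'rV[int]_n) (o a b : iwahori n) (x : 'rV[R]_n) :
  region R c n x -> region R c n (aff_act o x) ->
  bruhat_step (@affine_weyl c n) (simple_reflections R c (n := n)) a b ->
  orbit_hull c m (aff_act (b * o)%g x - x) ->
  orbit_hull c m (aff_act (a * o)%g x - x).
Proof.
move=> rx rox /(bruhat_step_separates hn) [t [al [d [Wt ral act bE neg]]]].
have -> : a = (t * b)%g by rewrite bE mulgA (reflection_involution ral act) mul1g.
rewrite -mulgA [aff_act (t * _)%g x]aff_actM; set y := aff_act (b * o)%g x;
  set v := y - x.
(* Both [x] and [o x] lie in [A], so the separation of [p] from [b p] passes to [x] and [b o x]. *)
have yx : aff al d y * aff al d x < 0.
  have s1 := aff_act_region_same_side b d ral rox.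
  have s2 := rx al d ral.
  rewrite /y aff_actM; rewrite ltNge; apply/negP; rewrite le_eqVlt => /orP[|pos].
    rewrite eq_sym mulf_eq0 => /orP[] /eqP e0; [move: s1|move: s2];
      by rewrite e0 mulr0 ltxx.
  have := pos_mul_trans s1 pos; rewrite mulrC => s3.
  have s4 := pos_mul_trans s2 s3.
  by move: neg; rewrite ltNge ltW.
have al0 := root_dot_gt0 ral.
have alv : dot al v = aff al d y - aff al d x by rewrite /v dotBr opprB addrA subrK.
have alv0 : dot al v != 0.
  by rewrite alv; apply: contraTneq yx => /eqP; rewrite subr_eq0 => /eqP ->;
    rewrite -leNgt -expr2 sqr_ge0.
(* The denominator is the value at [y] minus the value at [x], and these have opposite signs: the
   coefficient lies in [0, 1]. *)
have -> : aff_act t y - x = v + (aff al d y / dot al v) *: (sact (spart t) v - v).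
  rewrite (reflection_linear v act) act /hyperplane_reflection -/(aff al d y)
    addrAC -/v.
  congr (_ + _); rewrite addrAC subrr add0r scalerN scalerA; congr (- (_ *: _)).
  by field; rewrite alv0 gt_eqF.
move=> hv; apply: orbit_hull_segment => //; last by apply: orbit_hull_sact => //;
  case: Wt.
rewrite alv; move: yx alv0; rewrite alv; set A := aff al d y;
  set B := aff al d x => AB _.
have [A0|A0|A0] := ltrgt0P A; last by move: AB; rewrite A0 mul0r ltxx.
  have B0 : B < 0 by move: AB; rewrite pmulr_rlt0.
  by rewrite divr_ge0 ?ler_pdivrMr ?mul1r; lra.
have B0 : 0 < B by move: AB; rewrite nmulr_rlt0.
apply/andP; split; first by apply: mulr_le0; rewrite ?invr_le0; lra.
by rewrite ler_ndivrMr ?mul1r; lra.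
Qed.

Lemma admissible_permissible (m : 'rV[int]_n) :
  admissible_set R c m `<=` permissible_set R c m.
Proof.
move=> w [_ [s ws <-] [u [u' [z [Wu Wu' stab_z [wE tE] [_ steps]]]]]].
split.
  have -> : (w * (translation m)^-1)%g =
      ((u * u'^-1) * (translation (sact s m) * (translation m)^-1))%g.
    by rewrite tE wE; move: (_^-1)%g => t; rewrite -!mulgA mulKg.
  apply: affine_weylM; first by apply: affine_weylM => //; exact: affine_weylV.
  rewrite translationV translationM; split; last exact: finite_weyl1.
  exact: coroot_lattice_sactB.
move=> x; rewrite base_alcoveE // => rx.
have rox : region R c n (aff_act z x).
  by move: stab_z; rewrite /alcove_stabilizer /= base_alcoveE // => <-; exists x.
rewrite wE; have : orbit_hull c m (aff_act (u' * z)%g x - x).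
  rewrite -tE /aff_act sact1 addrK; apply: orbit_hull_orbit.
  by exists s.
elim: steps => [a b|//|a b d _ IH1 _ IH2 h]; first exact: bruhat_step_hull.
by apply: IH1; apply: IH2.
Qed.

End Admissible.
(** * Raising a permissible element *)

Definition ones n (j : nat) : 'rV[int]_n := \row_i ((i < j)%N : nat)%:Z.

Lemma hat_ones n j k : (j <= n)%N ->
  hat (ones n j) k = ((k < j)%N : nat)%:Z - ((rev_ord k < j)%N : nat)%:Z.
Proof.
move=> jn; elim/half_ind: k => i; rewrite ?hat_rev hat_lshift mxE /=;
  have := ltn_ord i; lia.
Qed.

(** Hence [base_point] is the convex combination of the points [ones n j] / 2 with weight 1/(2n+1)
    at j = 0 and 2/(2n+1) at every other j. *)
Lemma rho_ones n : rho n = \sum_(j < n) ones n j.+1.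
Proof.
apply/rowP => i; rewrite summxE mxE.
under eq_bigr do rewrite mxE.
have := ltn_ord i; move: (i : nat) => m mn; suff : forall N, \sum_(j < N) ((m <
  j.+1)%N : nat)%:Z = (N - m)%N%:Z.
  by move=> ->; lia.
by elim=> [|N IH]; rewrite ?big_ord0 ?big_ord_recr ?IH /=; lia.
Qed.

Lemma hat_sum (V : zmodType) n (I : Type) (r : seq I) (F : I -> 'rV[V]_n) k :
  hat (\sum_(j <- r) F j) k = \sum_(j <- r) hat (F j) k.
Proof. by elim: r => [|j r IH]; rewrite ?big_nil ?hat0 // !big_cons hatD IH. Qed.

Lemma ones_separates n (k l : 'I_(n + n)) :
  (forall j, (j <= n)%N -> hat (ones n j) k = hat (ones n j) l) -> k = l.
Proof.
move=> e; apply: hat_rho_inj; rewrite rho_ones !hat_sum.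
by apply: eq_bigr => j _; apply: e.
Qed.

(* Twice the displacement by [w] of the point (1/2, ..., 1/2, 0, ..., 0) with
   [j] nonzero entries; these points lie in the closure of the base alcove. *)
Definition disp n (w : iwahori n) (j : nat) : 'rV[int]_n :=
  tpart w *+ 2 + sact (spart w) (ones n j) - ones n j.

Lemma hat_disp n (w : iwahori n) j k : hat (disp w j) k =
  hat (tpart w) k * 2 + hat (ones n j) ((sgval (spart w))^-1%g k) - hat (ones n
    j) k.
Proof. by rewrite hatB hatD hat_mulrn hat_sact mulr_natr. Qed.

(** The bound is l^1-norm 1, doubled by [disp] and again by [hat_norm]. *)
Definition small_disp n (w : iwahori n) :=
  forall j, (j <= n)%N -> hat_norm (disp w j) <= 4.

Lemma hat_norm_pairroot n (x : 'rV[int]_n) (B : int) a b :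
  b != a -> b != rev_ord a ->
  hat_norm (x + (evec int a - evec int b) *~ B) =
  hat_norm x + 2 * (`|hat x a + B| + `|hat x b - B| - `|hat x a| - `|hat x b|).
Proof.
move=> ba bra; have rab : rev_ord b != a by rewrite eq_revL.
apply/eqP; rewrite [_ + 2 * _]addrC -subr_eq; apply/eqP; rewrite /hat_norm -sumrB.
have ala : hat (evec int a - evec int b) a = 1 by rewrite hat_pairroot // eqxx.
have alb : hat (evec int a - evec int b) b = -1.
  by rewrite hat_pairroot // eqxx (negPf ba).
rewrite (bigD1 a) //= (bigD1 b) //= (bigD1 (rev_ord a)) /=; last first.
  by rewrite rev_ord_neq eq_sym bra.
rewrite (bigD1 (rev_ord b)) /=; last first.
  by rewrite rab rev_ord_neq (inj_eq rev_ord_inj) ba.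
rewrite big1 => [|k /andP[/andP[/andP[ka kb] kra] krb]].
  rewrite !hatD !hat_mulrz !hat_rev ala alb; move: (hat x a) (hat x b) => u v. lia.
rewrite hatD hat_mulrz hat_pairroot // (negPf ka) (negPf kb) (negPf kra) (negPf
  krb).
by rewrite mul0r addr0 subrr.
Qed.

Lemma hat_norm_pair n (x : 'rV[int]_n) a b : b != a -> b != rev_ord a ->
  2 * (`|hat x a| + `|hat x b|) <= hat_norm x.
Proof.
move=> ba bra; have rab : rev_ord b != a by rewrite eq_revL.
rewrite /hat_norm (bigD1 a) //= (bigD1 b) //= (bigD1 (rev_ord a)) /=;
  last by rewrite rev_ord_neq eq_sym bra.
rewrite (bigD1 (rev_ord b)) /=; last first.
  by rewrite rab rev_ord_neq (inj_eq rev_ord_inj) ba.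
rewrite !hat_rev !normrN; set r := \sum_(_ | _) _.
have r0 : 0 <= r by apply: sumr_ge0.
by clearbody r; move: (hat x a) (hat x b) => u v; lia.
Qed.

Lemma hat_norm_single n (x : 'rV[int]_n) a : 2 * `|hat x a| <= hat_norm x.
Proof.
rewrite /hat_norm (bigD1 a) //= (bigD1 (rev_ord a)) /=; last by rewrite rev_ord_neq.
rewrite hat_rev normrN; set r := \sum_(_ | _) _.
have r0 : 0 <= r by apply: sumr_ge0.
by clearbody r; move: (hat x a) => u; lia.
Qed.

(** Let [t] be the reflection, [s] its linear part and f = al - d. Since [t] is an involution, t w x
    - x = s (w x - t x) = s (w x - x + f(x) al); the integer multiplying the root is 2 f(x). *)
Lemma disp_long_refl n (w : iwahori n) a b d j : b != a -> b != rev_ord a ->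
  disp (long_refl a b d * w)%g j = sact (swap a b) (disp w j +
    (evec int a - evec int b) *~ (hat (ones n j) a - hat (ones n j) b - 2 * d)).
Proof.
move=> ba bra; have rab : rev_ord b != a by rewrite eq_revL.
apply: hat_inj => k; rewrite hat_disp [RHS]hat_sact [RHS]hatD hat_disp hat_mulrz.
rewrite /= hatD hat_mulrz hat_sact invMg permM !swapV // !hat_pairroot // swapE //.
have [->|ka] := eqVneq k a; first by rewrite (negPf ba) eqxx; ring.
have [->|kb] := eqVneq k b; first by rewrite eqxx; ring.
have [->|kra] := eqVneq k (rev_ord a).
  rewrite (negPf rab) rev_ord_neq (inj_eq rev_ord_inj) (negPf ba) eqxx !hat_rev;
    ring.
have [->|krb] := eqVneq k (rev_ord b).
  by rewrite rev_ord_neq eq_revL eq_sym (negPf rab) eqxx !hat_rev; ring.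
by rewrite (negPf ka) (negPf kb) (negPf kra) (negPf krb); ring.
Qed.
Lemma aff_act1 (R : realType) n (x : 'rV[R]_n) : aff_act 1%g x = x.
Proof. by rewrite /aff_act map_mx0 add0r sact1. Qed.

(** The hypothesis bounds twice the affine root at the images of the points [ones n j] / 2;
    convexity carries it to the image of [p]. *)
Lemma aff_base_point_ge0 (R : realType) n (w : iwahori n) a b d :
  (forall j, (j <= n)%N -> 0 <= 2 * (hat (tpart w) a - hat (tpart w) b - d) +
     (hat (ones n j) ((sgval (spart w))^-1%g a) -
      hat (ones n j) ((sgval (spart w))^-1%g b))) ->
  0 <= aff (evec R a - evec R b) d (aff_act w (base_point R n)).
Proof.
move=> ge0; have M0 : (n + n).+1%:R != 0 :> R by rewrite pnatr_eq0.
set a' := ((sgval (spart w))^-1%g a) in ge0; set b' := ((sgval (spart w))^-1%g b)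
  in ge0.
set X := hat (tpart w) a - hat (tpart w) b - d in ge0.
have -> : aff (evec R a - evec R b) d (aff_act w (base_point R n)) =
    (X * (n + n).+1%:Z + (hat (rho n) a' - hat (rho n) b'))%:~R / (n + n).+1%:R.
  rewrite /aff dot_pairroot !hat_aff !hat_base_point -/a' -/b' /X.
  rewrite !(rmorphD, rmorphM, rmorphN) /= -pmulrn; by field.
rewrite divr_ge0 // ler0z rho_ones !hat_sum -sumrB.
have X0 : 0 <= X.
  have := ge0 0%N isT; rewrite !hat_ones //; lia.
have : 0 <= \sum_(j < n) (2 * X + (hat (ones n j.+1) a' - hat (ones n j.+1) b')).
  by apply: sumr_ge0 => j _; apply: ge0.
rewrite big_split sumr_const card_ord /= -mulr_natr natz.
by move: (\sum_(_ < _) _) => D; lia.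
Qed.

Definition raises (R : realType) c n (t w : iwahori n) :=
  affine_weyl c t /\ exists (al : 'rV[R]_n) d,
    [/\ root_system c al, acts_as_reflection t al d, 0 < aff al d (base_point R n)
      & 0 < aff al d (aff_act w (base_point R n))].

(** For x = [ones n j] / 2, [B] is 2 f(x) and [B + u - v] is 2 f(w x). The third condition keeps the
    bound: the norm does not grow, or it grows from 0 to 4 [B], which is at most 4. *)
Lemma raise_long (R : realType) c n (w : iwahori n) a b d :
  b != a -> b != rev_ord a -> small_disp w ->
  (forall j, (j <= n)%N ->
     let B := hat (ones n j) a - hat (ones n j) b - 2 * d in
     let u := hat (disp w j) a in let v := hat (disp w j) b in
     [/\ 0 <= B, 0 <= B + u - v &
       `|u + B| + `|v - B| <= `|u| + `|v| \/ hat_norm (disp w j) = 0 /\ B <= 1]) ->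
  small_disp (long_refl a b d * w)%g /\ raises R c (long_refl a b d) w.
Proof.
move=> ba bra sw hj; split.
  move=> j jn; rewrite disp_long_refl // hat_norm_sact hat_norm_pairroot //.
  have := sw j jn; have [B0 _ third] := hj j jn.
  have := hat_norm_single (disp w j) a; have := hat_norm_single (disp w j) b.
  move: (hat_norm _) (hat (disp w j) a) (hat (disp w j) b) B0 third => N u v.
  by move: (_ - 2 * d) => B B0 third h1 h2 h3; case: third => [|[]]; lia.
split; first exact: affine_weyl_long_refl.
have ral : root_system c (evec R a - evec R b).
  by apply/root_systemP; left; exists a, b.
exists (evec R a - evec R b), d; split => //; first exact: long_reflP.
  rewrite lt_def -{1}[base_point R n]aff_act1 (aff_base_point_neq0 _ _ ral).
  rewrite -[base_point R n]aff_act1 aff_base_point_ge0 // => j jn /=.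
  rewrite !hat0 invg1 !perm1; have [] := hj j jn => + _ _.
  by move: (hat (ones n j) a) (hat (ones n j) b) => u v; lia.
rewrite lt_def (aff_base_point_neq0 _ _ ral) aff_base_point_ge0 // => j jn.
have [] := hj j jn => _ + _; rewrite !hat_disp.
move: (hat (tpart w) a) (hat (tpart w) b) => u v.
move: (hat (ones n j) ((sgval (spart w))^-1%g a)) (hat (ones n j) ((sgval (spart
  w))^-1%g b)) => u1 v1.
by move: (hat (ones n j) a) (hat (ones n j) b) => u2 v2; lia.
Qed.

Lemma perm_stable_inv (T : finType) (s : {perm T}) (A : {pred T}) x :
  (forall y, y \in A -> s y \in A) -> s x \in A -> x \in A.
Proof.
move=> sA sxA; pose B := finset A.
have sub : (s @: B)%SET \subset B.
  by apply/fintype.subsetP => _ /imsetP [y + ->]; rewrite !inE; exact: sA.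
have /eqP e : (s @: B)%SET == B.
  by rewrite eqEcard sub (card_imset _ (@perm_inj _ s)) leqnn.
have : s x \in (s @: B)%SET by rewrite e inE.
by move=> /imsetP [y + /perm_inj ->]; rewrite inE.
Qed.

Lemma hat_norm_evec (K : numDomainType) n (k : 'I_(n + n)) : hat_norm (evec K k)
  = 2.
Proof.
rewrite /hat_norm (bigD1 k) //= (bigD1 (rev_ord k)) /=; last by rewrite rev_ord_neq.
rewrite big1 => [|m /andP[mk mrk]].
  rewrite hat_rev normrN hat_evec eqxx [k == _]eq_sym rev_ord_neq subr0 normr1
    addr0.
  by rewrite -[2]/(1 + 1).
rewrite hat_evec eq_sym (negPf mk) [k == _]eq_sym eq_revL (negPf mrk) subrr.
exact: normr0.
Qed.

(** * Choice of the raising reflection *)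

Section Raise.
Variables (R : realType) (c : orthogonal_type) (n : nat) (w : iwahori n).
Local Notation sg := (sgval (spart w)).
Local Notation h j k := (hat (ones n j) k).

Hypothesis sw : small_disp w.

(** The coordinate [ka] and its conjugate already use the whole norm 4, so no other coordinate
    moves, for any j; the vectors [ones n j] together separate the indices. *)
Lemma spart_fixed_eq1 ka : tpart w = evec int ka -> sg ka = ka -> spart w = 1%g.
Proof.
move=> tw fka; have fkaV : sg^-1%g ka = ka by rewrite -{1}fka permK.
apply: sstar_eq => m; rewrite perm1.
have [->//|mka] := eqVneq m ka.
have [->|mra] := eqVneq m (rev_ord ka); first by rewrite sgval_rev fka.
suff e : sg^-1%g m = m by rewrite -{1}e permKV.
apply: ones_separates => j jn.
have := hat_norm_pair (disp w j) mka mra; have := sw jn.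
rewrite !hat_disp tw !hat_evec fkaV eqxx [ka == rev_ord ka]eq_sym rev_ord_neq.
rewrite [ka == m]eq_sym (negPf mka) [ka == rev_ord m]eq_sym eq_revL (negPf mra).
by move: (hat_norm _) (h j ka) (h j m) (h j (sg^-1%g m)) => N x y z; lia.
Qed.

(** If sigma moves k, it maps k to a smaller index, and the reflection in x_(sigma k) = x_k raises
    [w]. *)
Lemma raise_negative k : tpart w = evec int (rev_ord (lshift n k)) ->
  spart w = 1%g \/ exists t, small_disp (t * w)%g /\ raises R c t w.
Proof.
move=> tw; set kk := lshift n k in tw.
have [fk|nfk] := eqVneq (sg kk) kk.
  by left; apply: (spart_fixed_eq1 tw); rewrite sgval_rev fk.
right; have kn : (k.+1 <= n)%N by exact: ltn_ord.
have kkk : kk = k :> nat by [].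
have tkk : hat (tpart w) kk = -1.
  by rewrite tw hat_evec rev_ord_neq eqxx.
have tm m : m != kk -> m != rev_ord kk -> hat (tpart w) m = 0.
  by move=> mk mrk; rewrite tw hat_evec eq_sym (negPf mrk) (inj_eq rev_ord_inj)
    eq_sym (negPf mk).
have hk1 : h k.+1 kk = 1 by rewrite hat_ones //=; lia.
(* For j = k+1 the bound forces displacement -2 at [kk], which exhausts the norm: the other
   coordinates of [ones n k.+1] are preserved. *)
have stab (m : 'I_(n + n)) : (m < k.+1)%N -> (sg^-1%g m < k.+1)%N.
  suff : h k.+1 m = 1 -> h k.+1 (sg^-1%g m) = 1.
    rewrite !hat_ones //=; have := ltn_ord m; have := ltn_ord (sg^-1%g m); lia.
  have hkk : h k.+1 (sg^-1%g kk) = 1.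
    have := hat_norm_single (disp w k.+1) kk; have := sw kn;
      rewrite hat_disp tkk hk1.
    rewrite hat_ones //; lia.
  have [->//|mk] := eqVneq m kk; have [->|mrk] := eqVneq m (rev_ord kk).
    by rewrite hat_rev hk1.
  have := hat_norm_pair (disp w k.+1) mk mrk; have := sw kn.
  by rewrite !hat_disp tkk hk1 hkk tm //; move: (hat_norm _) (h k.+1 m) (h k.+1
    (sg^-1%g m)) => N x y; lia.
have skk : (sg kk < k)%N.
  have : (sg kk < k.+1)%N.
    have := @perm_stable_inv _ (sg^-1)%g [pred m : 'I_(n + n) | (m < k.+1)%N] (sg
      kk).
    by rewrite !inE permK; apply => // m; rewrite !inE; apply: stab.
  rewrite ltnS leq_eqVlt => /orP[/eqP e|//]; case/eqP: nfk; exact: val_inj.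
have ba : kk != sg kk by rewrite eq_sym.
have bra : kk != rev_ord (sg kk).
  by apply/eqP => /(congr1 val) /=; have := ltn_ord k; lia.
exists (long_refl (sg kk) kk 0); apply: raise_long => // j jn /=.
have t_skk : hat (tpart w) (sg kk) = 0 by apply: tm => //; rewrite -eq_revL eq_sym.
rewrite !hat_disp tkk t_skk permK.
rewrite !hat_ones //=; have := ltn_ord k; have := ltn_ord (sg^-1%g kk).
move: (sg kk) (sg^-1%g kk) skk => m l mk ln kn2.
split; [lia | lia | left; lia].
Qed.

Section Positive.
Variable k : 'I_n.
Local Notation kk := (lshift n k).
Hypothesis tw : tpart w = evec int kk.

Lemma hat_tpart_pos : hat (tpart w) kk = 1.
Proof. by rewrite tw hat_evec eqxx eq_sym rev_ord_neq. Qed.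

Lemma hat_tpart_other m : m != kk -> m != rev_ord kk -> hat (tpart w) m = 0.
Proof.
move=> mk mrk; rewrite tw hat_evec eq_sym (negPf mk) [kk == _]eq_sym eq_revL.
by rewrite (negPf mrk).
Qed.

(* The reflection in x_q + x_k = 1. *)
Lemma raise_opposite q : q != kk -> q != rev_ord kk -> (q < n)%N ->
  sg q = rev_ord kk -> (q <= sg^-1%g q)%N ->
  exists t, small_disp (t * w)%g /\ raises R c t w.
Proof.
move=> qkk qrkk qn sq qV.
have sqV : sg^-1%g kk = rev_ord q.
  by apply: (@perm_inj _ sg); rewrite permKV sgval_rev sq rev_ordK.
exists (long_refl (rev_ord q) kk (-1)); apply: raise_long => //.
- by rewrite eq_sym eq_revL.
- by rewrite rev_ordK eq_sym.
move=> j jn /=.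
have -> : hat (disp w j) (rev_ord q) = h j q - h j (sg^-1%g q).
  by rewrite hat_rev hat_disp hat_tpart_other //; ring.
have -> : hat (disp w j) kk = 2 - h j q - h j kk.
  by rewrite hat_disp hat_tpart_pos sqV hat_rev; ring.
rewrite !hat_rev !hat_ones //=.
have := ltn_ord (sg^-1%g q); move: qV; move: (sg^-1%g q) => m qm mn.
have -> : ((n + n - q.+1 < j) = false)%N by lia.
have -> : ((n + n - k.+1 < j) = false)%N by have := ltn_ord k; lia.
have : ((m < j)%N ==> (q < j)%N) by apply/implyP; lia.
case: (m < j)%N; case: (q < j)%N; case: (k < j)%N; case: (_ < j)%N => //= _;
  by split; [lia | lia | left; lia].
Qed.

Lemma raise_forward : (kk < sg kk)%N -> sg kk != rev_ord kk ->
  exists t, small_disp (t * w)%g /\ raises R c t w.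
Proof.
move=> kV skk; have nfk : sg kk != kk by apply: contraTneq kV => ->; rewrite ltnn.
exists (long_refl kk (sg kk) 0); apply: raise_long => // j jn /=.
rewrite !hat_disp hat_tpart_pos hat_tpart_other // permK; move: kV.
rewrite !hat_ones //=; have := ltn_ord (sg kk); have := ltn_ord (sg^-1%g kk).
move: (sg kk) (sg^-1%g kk) => m l /= mn ln km.
split; [lia | lia | left; lia].
Qed.

(** A flip is odd, which forces the odd case; there the short root e_k is available, and its
    reflection at level 0 leads to a translation at once. *)
Lemma raise_flip : finite_weyl c (spart w) -> spart w = flip kk ->
  exists t, small_disp (t * w)%g /\ raises R c t w.
Proof.
move=> fw flipw; have ec : c = OddOrthogonal.
  by case: (c) fw => //=; rewrite flipw (negPf (flip_odd kk)).
have tflip m : sg^-1%g m = tperm kk (rev_ord kk) m by rewrite flipw flipV.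
have wt : (short_refl kk 0 * w)%g = translation (evec int (rev_ord kk)).
  rewrite [LHS]/(iwahori_mul _ _); congr Iwahori; last first.
    by apply: sstar_eq => m; rewrite /= flipw permM !flipE tpermK perm1.
  by rewrite /= mulr0 mulr0z add0r tw sact_evec flipE tpermL.
have kn := ltn_ord k.
exists (short_refl kk 0); split.
  rewrite wt => j jn; rewrite /disp /= sact1 addrK mulr2n.
  have -> : hat_norm (evec int (rev_ord kk) + evec int (rev_ord kk)) =
      hat_norm (evec int (rev_ord kk)) * 2.
    rewrite /hat_norm mulr_suml; apply: eq_bigr => m _.
    by rewrite hatD; move: (hat _ m) => u; lia.
  by rewrite hat_norm_evec.
split; first by rewrite ec; exact: affine_weyl_short_refl.
exists (evec R kk), 0; split.
- by apply/root_systemP; right; split => //; exists kk.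
- exact: short_reflP.
- by rewrite /aff dot_evec hat_base_point subr0 divr_gt0 // ltr0z hat_rho /= kn;
  lia.
rewrite /aff dot_evec hat_aff hat_tpart_pos tflip tpermL hat_base_point hat_rev.
rewrite subr0 rmorphN mulNr subr_gt0 ltr_pdivrMr // mul1r pmulrn ltr_int hat_rho.
by rewrite /= kn; lia.
Qed.

Let moved l := [&& sg l != l, l != kk & l != rev_ord kk].

(** With q the least moved index other than k and its conjugate, the reflection in x_q + x_k = 1
    works; it belongs to a long root and so exists in both cases. *)
Lemma raise_two_flips l : sg kk = rev_ord kk -> moved l ->
  (forall i, sg i != i -> (k <= i)%N) ->
  exists t, small_disp (t * w)%g /\ raises R c t w.
Proof.
move=> skk ml min_k.
have [q mq min_q] : exists2 q, moved q & forall i, moved i -> (q <= i)%N.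
  by case: (@arg_minnP _ l moved val ml) => q ? ?; exists q.
have moved_rev i : moved i -> moved (rev_ord i).
  move=> /and3P[i1 i2 i3]; apply/and3P; split.
  - by rewrite sgval_rev (inj_eq rev_ord_inj).
  - by rewrite eq_revL.
  - by rewrite (inj_eq rev_ord_inj).
have movedV i : moved i -> moved (sg^-1%g i).
  move=> /and3P[i1 i2 i3]; apply/and3P; split.
  - by rewrite permKV; apply: contra_neq i1 => e; rewrite {1}e permKV.
  - by apply: contra_neq i3 => e; rewrite -skk -e permKV.
  - by apply: contra_neq i2 => e; rewrite -[kk]rev_ordK -skk -sgval_rev -e permKV.
have zero i j : (j <= n)%N -> (j <= q)%N -> moved i -> h j i = 0.
  move=> jn jq mi; have qi := min_q _ mi; have qri := min_q _ (moved_rev _ mi).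
  by rewrite hat_ones // !ltnNge (leq_trans jq qi) (leq_trans jq qri).
have /and3P[nfq qkk qrkk] := mq.
have kq : (k < q)%N.
  have := min_k _ nfq; rewrite leq_eqVlt => /orP[/eqP e|//].
  by case/eqP: qkk; apply: val_inj.
have qn : (q < n)%N.
  have := min_q _ (moved_rev _ mq); rewrite /=; have := ltn_ord q; clear; lia.
have skkV : sg^-1%g kk = rev_ord kk.
  by apply: (@perm_inj _ sg); rewrite permKV sgval_rev skk rev_ordK.
exists (long_refl (rev_ord q) kk (-1)); apply: raise_long => //.
- by rewrite eq_sym eq_revL.
- by rewrite rev_ordK eq_sym.
move=> j jn /=.
have -> : hat (disp w j) (rev_ord q) = h j q - h j (sg^-1%g q).
  by rewrite hat_rev hat_disp hat_tpart_other //; ring.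
have vE : hat (disp w j) kk = 2 - h j kk * 2.
  by rewrite hat_disp hat_tpart_pos skkV hat_rev; ring.
rewrite vE hat_rev.
have hsmall (i : 'I_n) : h j (lshift n i) = ((i < j)%N : nat)%:Z.
  by rewrite hat_lshift mxE.
have hq : h j q = ((q < j)%N : nat)%:Z.
  by rewrite -(hsmall (Ordinal qn)); congr (h j _); apply: val_inj.
rewrite hsmall hq; have [jq|qj] := leqP j q; last first.
  have : h j (sg^-1%g q) <= 1.
    by rewrite hat_ones //; do 2 case: (_ < j)%N.
  rewrite (ltn_trans kq qj); move: (h j _) => x x1; clear -x1.
  by split; [lia | lia | left; lia].
rewrite (zero _ _ jn jq (movedV _ mq)).
have [jk|kj] := leqP j k; first by split; [| |left].
(* For k < j <= q the point is fixed by [w] and [B] is 1; this is what the second alternative in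
   [raise_long] is for. *)
split=> //; right; split=> //.
rewrite /hat_norm big1 // => m _; apply/normr0P/eqP.
have [->|mk] := eqVneq m kk; first by rewrite vE hsmall kj.
have [->|mrk] := eqVneq m (rev_ord kk); first by rewrite hat_rev vE hsmall kj.
rewrite hat_disp hat_tpart_other // mul0r add0r.
have [e|nfm] := eqVneq (sg m) m; first by rewrite -{1}e permK subrr.
have mm : moved m by apply/and3P.
by rewrite (zero _ _ jn jq (movedV _ mm)) (zero _ _ jn jq mm) subrr.
Qed.

(** The choice depends on the least index q moved by sigma: for q = k it depends on sigma k and on
    the other moved indices, and for q < k the bound leaves only the situation of
    [raise_opposite]. *)
Lemma raise_positive : finite_weyl c (spart w) ->
  spart w = 1%g \/ exists t, small_disp (t * w)%g /\ raises R c t w.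
Proof.
move=> fw.
have [fk|nfk] := eqVneq (sg kk) kk; first by left; apply: (spart_fixed_eq1 tw).
right; have kn : (k < n)%N by exact: ltn_ord.
have [q nfq minq] : exists2 q, sg q != q & forall i, sg i != i -> (q <= i)%N.
  by case: (@arg_minnP _ kk (fun i => sg i != i) val nfk) => q ? ?; exists q.
have qn : (q < n)%N.
  have : (q <= rev_ord q)%N by apply: minq; rewrite sgval_rev (inj_eq rev_ord_inj).
  by rewrite /=; have := ltn_ord q; clear; lia.
have qV' : sg^-1%g q != q by apply: contra_neq nfq => {1}<-; rewrite permKV.
have qV : (q <= sg^-1%g q)%N by apply: minq; rewrite permKV eq_sym.
have := minq _ nfk; rewrite leq_eqVlt => /orP[/eqP/val_inj qk|qk].
  have [skk|skk] := eqVneq (sg kk) (rev_ord kk); last first.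
    apply: raise_forward => //.
    have : (q <= sg kk)%N by apply: minq; rewrite (inj_eq (@perm_inj _ sg)).
    by rewrite qk leq_eqVlt => /orP[/eqP/val_inj e|//]; rewrite -e eqxx in nfk.
  have [l ml|none] := pickP moved.
    by apply: (raise_two_flips skk ml) => i /minq; rewrite qk.
  apply: raise_flip => //; apply: sstar_eq => m; rewrite flipE.
  case: tpermP => [->//|->|/eqP mk /eqP mrk];
    first by rewrite sgval_rev skk rev_ordK.
  by have := none m; rewrite /moved mk mrk !andbT => /negbFE/eqP.
have qkk : q != kk by apply: contraTneq qk => ->; rewrite ltnn.
have qrkk : q != rev_ord kk.
  by apply: contraTneq qn => ->; rewrite /=; clear -kn; lia.
(* At j = q+1 the displacement at q is at most -1, which leaves at most 1 in absolute value at k,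
   where the translation contributes 2. So sigma^-1 k is conjugate to an index at most q, which is q
   by minimality. *)
apply: (raise_opposite qkk qrkk qn _ qV).
have := hat_norm_pair (disp w q.+1) qkk qrkk; have := sw qn.
rewrite !hat_disp hat_tpart_pos hat_tpart_other //.
have -> : h q.+1 q = 1 by rewrite hat_ones //= ltnSn; clear -qn; lia.
have -> : h q.+1 kk = 0.
  by rewrite hat_ones //=; move: qk => /= qk; clear -qk qn kn; lia.
have : h q.+1 (sg^-1%g q) <= 0.
  have ltq : (q < sg^-1%g q)%N by rewrite ltn_neqAle eq_sym qV' qV.
  by rewrite hat_ones // ltnS leqNgt ltq; case: (_ < _)%N.
move: (h _ (sg^-1%g q)) (hat_norm _) => x N x0 b1 b2.
have : h q.+1 (sg^-1%g kk) <= -1.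
  by move: b1 b2; move: (h _ _) => y; clear -x0; lia.
have sl : sg (rev_ord (sg^-1%g kk)) = rev_ord kk by rewrite sgval_rev permKV.
move=> neg; suff <- : rev_ord (sg^-1%g kk) = q by [].
apply: val_inj; apply/eqP; rewrite eqn_leq; apply/andP; split.
  by move: neg; rewrite hat_ones // !ltnS; case: (rev_ord _ <= q)%N => //;
    case: (_ <= q)%N.
apply: minq; rewrite sl (inj_eq rev_ord_inj); apply: contraTneq neg => <-.
by rewrite hat_ones //=; move: qk => /= qk; clear -qk qn kn; lia.
Qed.

End Positive.
End Raise.
(** * Permissible elements are admissible *)

Section HatNorm.
Variables (K : numDomainType) (n : nat).
Implicit Types (x y : 'rV[K]_n).

Lemma hat_normD x y : hat_norm (x + y) <= hat_norm x + hat_norm y.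
Proof.
by rewrite /hat_norm -big_split; apply: ler_sum => k _; rewrite hatD ler_normD.
Qed.

Lemma hat_normZ (s : K) x : hat_norm (s *: x) = `|s| * hat_norm x.
Proof.
by rewrite /hat_norm mulr_sumr; apply: eq_bigr => k _; rewrite hatZ normrM.
Qed.

Lemma hat_norm_map (x : 'rV[int]_n) :
  hat_norm (map_mx intr x : 'rV[K]_n) = (hat_norm x)%:~R.
Proof.
by rewrite /hat_norm rmorph_sum; apply: eq_bigr => k _;
  rewrite hat_map /= intr_norm.
Qed.

End HatNorm.

Lemma mu_evec n (hn : (2 <= n)%N) : mu n = evec int (lshift n (Ordinal (ltnW hn))).
Proof.
by apply/rowP => i; rewrite evec_lshift !mxE.
Qed.

Lemma hat_norm_le2 n (v : 'rV[int]_n) : hat_norm v <= 2 -> v <> 0 ->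
  exists k, v = evec int k.
Proof.
move=> v2 v0.
have [k hk] : exists k, 0 < hat v k.
  have [k nk] : exists k, hat v k != 0.
    apply: contrapT => none; apply: v0; apply: hat_inj => k; rewrite hat0.
    by apply/eqP/negPn/negP => nk; apply: none; exists k.
  have [lt|gt|e] := ltrgt0P (hat v k); last by rewrite e eqxx in nk.
    by exists k.
  by exists (rev_ord k); rewrite hat_rev oppr_gt0.
exists k; apply: hat_inj => l; rewrite hat_evec.
have [->|lk] := eqVneq l k.
  rewrite eq_sym rev_ord_neq subr0; have := hat_norm_single v k.
  by move: hk v2; move: (hat v k) (hat_norm v) => u N; lia.
have [->|lrk] := eqVneq l (rev_ord k).
  rewrite rev_ordK eqxx hat_rev; have := hat_norm_single v k.
  by move: hk v2; move: (hat v k) (hat_norm v) => u N; lia.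
rewrite [k == rev_ord l]eq_sym eq_revL (negPf lrk).
have := hat_norm_pair v lk lrk.
by move: hk v2; move: (hat v k) (hat v l) (hat_norm v) => u u' N; lia.
Qed.

Lemma weyl_orbit_evec c n (hn : (2 <= n)%N) (k : 'I_(n + n)) :
  weyl_orbit c (mu n) (evec int k).
Proof.
rewrite (mu_evec hn); set i0 := lshift n _; pose i1 := lshift n (Ordinal hn).
have [->|k0] := eqVneq k i0; first by exists 1%g;
  [exact: finite_weyl1 | rewrite sact1].
have [->|kr0] := eqVneq k (rev_ord i0); last first.
  exists (swap i0 k); first by have := swap_Scirc k0 kr0; case: c.
  by rewrite sact_evec swapE // eqxx.
(* The sign at [i1], where [mu] is 0, is changed as well to make the permutation even. *)
exists (flip i1 * flip i0)%g.
  have := flip_odd i0; have := flip_odd i1; rewrite /finite_weyl.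
  by case: c => //=; rewrite !inE !negbK odd_permM => -> ->.
rewrite sact_evec /= permM !flipE (tpermD (z := i0)) ?tpermL ?rev_lshift_neq //.
Qed.

Section Permissible.
Variables (R : realType) (c : orthogonal_type) (n : nat).
Hypothesis hn : (2 <= n)%N.
Implicit Types (w t u o : iwahori n).
Local Notation p := (base_point R n).
Local Notation M := ((n + n).+1%:R : R).
Local Notation W := (@affine_weyl c n).
Local Notation S := (@simple_reflections R c n).

Lemma small_disp_evec w : small_disp w -> ~ coroot_lattice (tpart w) ->
  exists k, tpart w = evec int k.
Proof.
move=> sw nc; apply: hat_norm_le2.
  have := sw 0%N isT; have -> : disp w 0 = tpart w + tpart w.
    have o0 : ones n 0 = 0 by apply/rowP => i; rewrite !mxE.
    by rewrite /disp o0 sact0 addr0 subr0 mulr2n.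
  have -> : hat_norm (tpart w + tpart w) = hat_norm (tpart w) * 2.
    rewrite /hat_norm mulr_suml; apply: eq_bigr => m _.
    by rewrite hatD; move: (hat _ m) => u; lia.
  by move: (hat_norm _) => N; lia.
by move=> t0; apply: nc; rewrite t0 /coroot_lattice /= big1 // => i _; rewrite mxE.
Qed.

(** A crude bound, each entry being at most 2 in absolute value; it serves only to stop the raising
    process. *)
Lemma dist_base_point_bound w k : tpart w = evec int k ->
  dot (aff_act w p - p) (aff_act w p - p) <= (4 * n)%:R.
Proof.
move=> tw; have M0 : 0 < M by rewrite ltr0n.
have -> : (4 * n)%:R = \sum_(i < n) 4 :> R.
  by rewrite sumr_const card_ord natrM mulr_natr.
apply: ler_sum => i _; rewrite -expr2 -!hat_lshift hatB hat_aff !hat_base_point tw.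
set l := ((sgval (spart w))^-1%g _); set m := lshift n i.
have := hat_rho_bound l; have := hat_rho_bound m => bm bl.
have [z zb ->] : exists2 z : int, `|z| <= 2 * (n + n).+1%:Z &
    (hat (evec int k) m)%:~R + (hat (rho n) l)%:~R / M - (hat (rho n) m)%:~R / M
      = z%:~R / M.
  exists (hat (evec int k) m * (n + n).+1%:Z + hat (rho n) l - hat (rho n) m).
    by rewrite hat_evec; case: (k == m); case: (k == rev_ord m); rewrite /=; lia.
  by rewrite !(rmorphD, rmorphM, rmorphN) /= -pmulrn; field; rewrite gt_eqF.
have : `|z%:~R / M| <= 2.
  rewrite normrM normfV (gtr0_norm M0) ler_pdivrMr //.
  by rewrite -intr_norm [2 * M](_ : _ = (2 * (n + n).+1%:Z)%:~R) ?ler_int //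
    rmorphM /= -pmulrn.
by rewrite ler_norml => /andP[]; move: (_ / M) => x; nra.
Qed.

Lemma raise w : small_disp w -> ~ coroot_lattice (tpart w) ->
  finite_weyl c (spart w) ->
  (exists k, w = translation (evec int k)) \/
  exists t, small_disp (t * w)%g /\ raises R c t w.
Proof.
move=> sw nc fw; have [k tw] := small_disp_evec sw nc.
have : spart w = 1%g \/ exists t, small_disp (t * w)%g /\ raises R c t w.
  move: tw; elim/half_ind: k => i tw; first exact: raise_positive tw fw.
  exact: raise_negative tw.
case=> [s1|]; [left; exists k | by right].
by case: (w) tw s1 => v s /= -> ->.
Qed.

(** The reflections multiply on the left, so [v] serves every factorization of [w]: [u] climbs in
    the affine Weyl group while the stabilizer part [o] stays fixed. *)
Lemma raise_to_translation w : small_disp w -> ~ coroot_lattice (tpart w) ->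
  finite_weyl c (spart w) -> exists k v,
  [/\ W v, translation (evec int k) = (v * w)%g &
    forall u o, W u -> region R c n (aff_act o p) -> w = (u * o)%g ->
      clos_refl_trans _ (bruhat_step W S) u (v * u)%g].
Proof.
have [N] := dist_base_point_nat R w.
(* [K] bounds the room left for the scaled squared distance [N], so induction descends while [N]
   grows. *)
have [K] : exists K, (4 * n * (n + n).+1 ^ 2 - N <= K)%N by exists (4 * n * (n +
  n).+1 ^ 2 - N)%N.
elim/ltn_ind: K N w => K IH N w NK eN sw nc fw.
have [[k ->]|[t [stw [Wt [al [d [ral act pp pw]]]]]]] := raise sw nc fw.
  exists k, 1%g; split; [exact: affine_weyl1 | by rewrite mul1g |].
  by move=> u o _ _ _; rewrite mul1g; apply: rt_refl.
have nctw : ~ coroot_lattice (tpart (t * w)%g).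
  move=> /= h; apply: nc; rewrite -(coroot_lattice_sact (spart t)).
  have := coroot_latticeD (coroot_latticeN Wt.1) h.
  by rewrite addrA addNr add0r.
have fwtw : finite_weyl c (spart (t * w)%g) by apply: finite_weylM => //;
  exact: Wt.2.
have [N' eN'] := dist_base_point_nat R (t * w)%g.
have [k tk] := small_disp_evec stw nctw.
have M20 : 0 < M ^+ 2 by rewrite exprn_gt0 // ltr0n.
have N'b : (N' <= 4 * n * (n + n).+1 ^ 2)%N.
  rewrite -(ler_nat R) -eN' natrM natrX ler_pM2r //;
    exact: dist_base_point_bound tk.
have NN' : (N < N')%N.
  rewrite -(ltr_nat R) -eN -eN' ltr_pM2r // aff_actM (dist_reflection _ _ ral act).
  rewrite ltrDl mulr_gt0 ?divr_gt0 ?(root_dot_gt0 ral) //; exact: mulr_gt0.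
have [|k' [v [Wv vE steps]]] := IH (4 * n * (n + n).+1 ^ 2 - N')%N _ N' _ (leqnn
  _) eN' stw nctw fwtw.
  by move: NK NN' N'b; move: (4 * n * _)%N => Z; lia.
exists k', (v * t)%g; split; [exact: affine_weylM | by rewrite vE mulgA |].
move=> u o Wu ro wE; apply: (rt_trans _ _ _ (t * u)%g).
  apply: rt_step; apply: (bruhat_step_reflection hn _ _ ral act) => //.
  have s := aff_act_region_same_side u d ral ro.
  rewrite -aff_actM -wE mulrC in s.
  by have := mulr_gt0 pp pw; move=> s'; apply: pos_mul_trans s' s.
rewrite -mulgA; apply: (steps (t * u)%g o) => //; first exact: affine_weylM.
by rewrite wE mulgA.
Qed.

Lemma region_stabilizer o : region R c n (aff_act o p) -> alcove_stabilizer R c o.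
Proof.
move=> ro; rewrite /alcove_stabilizer /= base_alcoveE //; apply/seteqP; split.
  move=> _ [x rx <-] al d ral.
  exact: (pos_mul_trans (ro _ d ral) (aff_act_region_same_side o d ral rx)).
move=> y ry; exists (aff_act o^-1%g y); last by rewrite -aff_actM mulgV aff_act1.
move=> al d ral.
have ral' := ral; have [al' [d' [rl _ e]]] := aff_pullback o^-1%g d ral.
have := pos_mul_trans (ro _ d' rl) _ (z := aff al' d' y).
have h1 := ro _ d' rl; have h2 := ry _ d' rl.
rewrite mulrC in h1; have := pos_mul_trans h1 h2.
by rewrite !e -aff_actM mulVg aff_act1.
Qed.

Lemma orbit_hull_norm (v : 'rV[R]_n) : orbit_hull c (mu n) v -> hat_norm v <= 2.
Proof.
suff : orbit_hull c (mu n) `<=` [set v : 'rV[R]_n | hat_norm v <= 2] by exact.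
apply: smallest_sub => [x y k|_ [m' [s _ <-] <-]].
  rewrite !inE /= => hx hy; rewrite conv_lmodE.
  have -> : (y : 'rV[R]_n) + k%:num *: ((x : 'rV[R]_n) - (y : 'rV[R]_n)) =
      (1 - k%:num) *: (y : 'rV[R]_n) + k%:num *: (x : 'rV[R]_n).
    by rewrite scalerBr scalerBl scale1r addrA addrAC.
  have k0 : 0 <= k%:num by []. have k1 : k%:num <= 1 by rewrite le1.
  apply: le_trans (hat_normD _ _) _; rewrite !hat_normZ !ger0_norm ?subr_ge0 //.
  by move: k0 k1 hx hy; move: (k%:num) (hat_norm _) (hat_norm _) => a b d; nra.
by rewrite /= hat_norm_map hat_norm_sact (mu_evec hn) hat_norm_evec.
Qed.

Lemma ones_closed j (al : 'rV[R]_n) d f : (j <= n)%N -> simple_affine c al d f ->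
  0 <= aff al d (2^-1 *: map_mx intr (ones n j)).
Proof.
move=> jn; case=> [i i' e|i i' e e' _|i e _|i i' e e'|i i' e e' _ _]; rewrite /aff;
  rewrite ?dot_pairroot ?dot_evec ?hat_rev ?hat_lshift !mxE ?subr0 -?pmulrn.
- have : ((i' < j)%N : nat)%:R <= ((i < j)%N : nat)%:R :> R by rewrite ler_nat; lia.
  lra.
- by have : 0 <= ((i < j)%N : nat)%:R :> R by [];
  have : 0 <= ((i' < j)%N : nat)%:R :> R by []; lra.
- by have : 0 <= ((i < j)%N : nat)%:R :> R by []; lra.
- have : ((i < j)%N : nat)%:R <= 1 :> R by rewrite lern1; lia.
  have : ((i' < j)%N : nat)%:R <= 1 :> R by rewrite lern1; lia.
  lra.
- have : ((i < j)%N : nat)%:R <= 1 :> R by rewrite lern1; lia.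
  have : 0 <= ((i' < j)%N : nat)%:R :> R by [].
  lra.
Qed.

(** Integrality replaces a limit. The displacement at the boundary point [e] is 9/8 of that at e +
    (p - e)/9 minus 1/8 of that at [p], so its [hat_norm] is at most 5/2. Doubled, it is an even
    integer at most 5, hence at most 4. *)
Lemma permissible_small_disp w : permissible_set R c (mu n) w -> small_disp w.
Proof.
move=> [_ hw] j jn.
pose e : 'rV[R]_n := 2^-1 *: map_mx intr (ones n j).
pose v (x : 'rV[R]_n) := aff_act w x - x.
have vb x : region R c n x -> hat_norm (v x) <= 2.
  by move=> rx; apply: orbit_hull_norm; apply: hw; rewrite base_alcoveE.
have hv x k : hat (v x) k =
    (hat (tpart w) k)%:~R + hat x ((sgval (spart w))^-1%g k) - hat x k.
  by rewrite /v hatB hat_aff.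
clearbody v.
have vE (s : R) x y : v (x + s *: (y - x)) = (1 - s) *: v x + s *: v y.
  by apply: hat_inj => k; rewrite [RHS]hatD !hatZ !hv !(hatD, hatN, hatZ); ring.
have seg := @closed_region_segment R c n hn e (fun al d f =>
  ones_closed jn (f := f)).
have r9 : region R c n (e + 9^-1 *: (p - e)) by apply: seg; lra.
have b9 := vb _ r9; have bp := vb _ (region_base_point hn).
have be : hat_norm (v e) <= 5 / 2.
  have -> : v e = (9 / 8) *: v (e + 9^-1 *: (p - e)) + (- 8^-1) *: v p.
    by rewrite vE; apply: hat_inj => k; rewrite !(hatD, hatZ); field.
  apply: le_trans (hat_normD _ _) _; rewrite !hat_normZ normrN !gtr0_norm;
    [|lra|lra].
  by move: b9 bp; move: (hat_norm _) (hat_norm _) => a b; lra.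
have de : map_mx intr (disp w j) = 2 *: v e.
  apply: hat_inj => k; rewrite hat_map hat_disp hatZ hv /e !hatZ !hat_map.
  by rewrite !(rmorphD, rmorphM, rmorphN) /=; field.
have : (hat_norm (disp w j))%:~R <= 5 :> R.
  rewrite -hat_norm_map de hat_normZ ger0_norm //.
  by move: be; move: (hat_norm _) => a; lra.
rewrite hat_normE (_ : 5 = 5%:~R) // ler_int.
by move: (\sum_i _) => N; lia.
Qed.

Lemma permissible_admissible : permissible_set R c (mu n) `<=` admissible_set R c
  (mu n).
Proof.
move=> w pw; have sw := permissible_small_disp pw; have [[lat fw] _] := pw.
rewrite translationV /= in lat; rewrite translationV /= mul1g in fw.
(* Every element in the class of the translation by [mu] has an odd coordinate sum. *)
have nc : ~ coroot_lattice (tpart w).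
  move=> lw; have := coroot_latticeD (coroot_latticeN lw) lat.
  rewrite addKr coroot_lattice_sact => /coroot_latticeN; rewrite opprK (mu_evec hn).
  have [e ee e12] := sum_evec (lshift n (Ordinal (ltnW hn))).
  by rewrite /coroot_lattice /= ee; case: e12 => ->.
have [k [v [Wv vE steps]]] := raise_to_translation sw nc fw.
(* Here [u w] stabilizes [A], so [u^-1] and [u w] are the two factors of [w] in the definition of
   the order. *)
have [u gu ru] := to_region R c hn w.
have Wu : W u^-1%g by apply/affine_weylV/(simple_product_affine_weyl gu).
have wE : w = (u^-1 * (u * w))%g by rewrite mulKg.
exists (evec int k); first exact: weyl_orbit_evec.
exists u^-1%g, (v * u^-1)%g, (u * w)%g; split=> //.
- exact: affine_weylM.
- exact: region_stabilizer.
- by rewrite -mulgA mulKg.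
by split => //; apply: steps ru wE.
Qed.

End Permissible.

Theorem mainTheorem1 (R : realType) (n : nat) (hn : (2 <= n)%N)
  (c : orthogonal_type) : admissible_set R c (mu n) = permissible_set R c (mu n).
Proof.
apply/seteqP; split; first exact: admissible_permissible.
exact: permissible_admissible.
Qed.
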